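(* For $k\ge2$, in the vertical spectral sequence of the double complex $(E_{p,q},d_h,d_v)$, the map $d^2\colon E^2_{1,k-3}\to E^2_{-1,k-2}$ is surjective. Consequently, the spectral sequence degenerates at the $E^3$ page, i.e. $E^3=E^\infty$.
   Context: All vector spaces and chain groups are over $\mathbb Z_2$. $G_k=(\mathbb Z_2)^k$ as a $k$-dimensional vector space. $X(G_k)$ is the simplicial complex with vertex set $G_k\setminus\{0\}$ and simplices the linearly independent subsets (including $\emptyset$, of dimension $-1$). $\widetilde C_*$ denotes augmented simplicial chains ($\widetilde C_{-1}=\mathbb Z_2\langle\emptyset\rangle$), $d^X$ the augmented boundary, $\operatorname{Lk}(\sigma)$ the link in $X(G_k)$. $S+\alpha=\{\beta+\alpha\mid\beta\in S\}$. Write $\sigma\sim\sigma'$ if $\sigma=\sigma'$ or they share a vertex $\alpha$ with $\sigma'\setminus\{\alpha\}=(\sigma\setminus\{\alpha\})+\alpha$; this is an equivalence relation, equivalent simplices have the same link. $c(\sigma)=\sum_{\sigma'\sim\sigma}\sigma'$. For $-1\le p\le k-1$, $q\ge-1$ put $E_{p,q}=\bigoplus_{\overline{\sigma^p}}\operatorname{span}\{c(\sigma^p)\}\otimes\widetilde C_q(\operatorname{Lk}\sigma^p)$ for $p\ge0$ (sum over equivalence classes of $p$-simplices), $E_{-1,q}=G_k\otimes\widetilde C_q(X(G_k))$ for $-1\le q\le k-2$, and $E_{p,q}=0$ otherwise. $d_v\colon E_{p,q}\to E_{p,q-1}$ applies $d^X$ to the second tensor factor. $d_h\colon E_{p,q}\to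 E_{p-1,q}$ is $d_h(c(\{\alpha\})\otimes\sigma^q)=\alpha\otimes\sigma^q$ for $p=0$; $d_h(c(\sigma^p)\otimes\sigma^q)=\bigl(c((\sigma^p\setminus\{\alpha\})+\alpha)+\sum_{\beta\in\sigma^p}c(\sigma^p\setminus\{\beta\})\bigr)\otimes\sigma^q$ for $p\ge1$ and any $\alpha\in\sigma^p$ (independent of choices); $d_h=0$ on $E_{-1,q}$. The (vertical) spectral sequence is the one of the double complex obtained by taking homology with respect to $d_v$ first: $E^0_{p,q}=E_{p,q}$, $E^1$ is the $d_v$-homology, and $d^r\colon E^r_{p,q}\to E^r_{p-r,q+r-1}$; it converges to the homology of the total complex $\mathfrak B_i(G_k)=\bigoplus_{p+q=i}E_{p,q}$ with differential $d_h+d_v$. *)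

(* Defs.v *)
From HB Require Import structures.
From mathcomp Require Import all_boot all_order all_algebra.
From mathcomp Require Import ring.

Set Implicit Arguments.
Unset Strict Implicit.
Unset Printing Implicit Defensive.
Import Order.TTheory GRing.Theory Num.Theory.
Local Open Scope ring_scope.

(** * Subquotients of a vector space *)

Section Subquotient.
Variables (K : fieldType) (W : vectType K).

Record subquot := Subquot { sq_num : {vspace W}; sq_den : {vspace W} }.

Definition sq_null (S : subquot) : {pred subvs_of (sq_num S)} :=
  [pred x | vsval x \in sq_den S].

Fact sq_null_zmod S : zmod_closed (@sq_null S).
Proof. by split=> [|x y]; rewrite !inE ?linear0 ?mem0v // linearB; apply: rpredB. Qed.
HB.instance Definition _ S :=
  GRing.isZmodClosed.Build (subvs_of (sq_num S)) (@sq_null S) (sq_null_zmod S).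

Definition sq_sort (S : subquot) : zmodType := Quotient.quot (@sq_null S).
Coercion sq_sort : subquot >-> zmodType.

(* meaningful for w \in sq_num S *)
Definition sq_class (S : subquot) (w : W) : S :=
  (\pi_(Quotient.quot (@sq_null S)) (vsproj (sq_num S) w))%qT.

Definition sq_repr (S : subquot) (x : S) : W :=
  vsval (repr (x : Quotient.quot (@sq_null S))).

Lemma sq_repr_num (S : subquot) (x : S) : sq_repr x \in sq_num S.
Proof. exact: subvsP. Qed.

Lemma sq_reprK (S : subquot) (x : S) : sq_class S (sq_repr x) = x.
Proof. by rewrite /sq_class /sq_repr vsvalK; apply: reprK. Qed.

Lemma sq_classP (S : subquot) v w : v \in sq_num S -> w \in sq_num S ->
  (sq_class S v = sq_class S w) <-> v - w \in sq_den S.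
Proof.
move=> Sv Sw; have := Quotient.idealrBE (@sq_null S)
  (vsproj (sq_num S) v) (vsproj (sq_num S) w).
rewrite inE linearB /= (vsprojK Sv) (vsprojK Sw) => ->.
by split=> [|/eqP//] E; apply/eqP.
Qed.

End Subquotient.

(** * Spectral sequence of a filtered complex *)

Section SpectralSequence.
Variables (K : fieldType) (W : vectType K).
(* F p n is the p-th filtration step in degree n, C n the whole degree n part,
   and d lowers the degree by one. *)
Variables (F : int -> int -> {vspace W}) (C : int -> {vspace W}) (d : 'End(W)).

Definition approx_cycles (r : nat) (p q : int) : {vspace W} :=
  (F p (p + q) :&: d @^-1: F (p - r%:Z) (p + q - 1))%VS.

(* All pages are subquotients of F_p / F_(p-1), whence the extra summand
   F_(p-1) in numerators and denominators. *)
Definition page (r : nat) (p q : int) : subquot W :=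
  Subquot (approx_cycles r p q + F (p - 1) (p + q))%VS
          (d @: approx_cycles r.-1 (p + r%:Z - 1) (q - r%:Z + 2)
             + F (p - 1) (p + q))%VS.

Definition page_infty (p q : int) : subquot W :=
  Subquot ((F p (p + q) :&: lker d) + F (p - 1) (p + q))%VS
          ((F p (p + q) :&: d @: C (p + q + 1)) + F (p - 1) (p + q))%VS.

(* The class of a + f, with a in approx_cycles r p q and f in F_(p-1), is sent
   to the class of d a (see page_diffE). *)
Definition page_diff (r : nat) (p q : int) (x : page r p q) :
    page r (p - r%:Z) (q + r%:Z - 1) :=
  sq_class (page r (p - r%:Z) (q + r%:Z - 1))
    (d (addv_pi1 (approx_cycles r p q) (F (p - 1) (p + q)) (sq_repr x))).

Lemma page_diffE (r : nat) (p q : int) (a : W) :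
    (forall m n : int, (F (m - 1) n <= F m n)%VS) ->
    (forall m n : int, (d @: F m n <= F m (n - 1))%VS) ->
    (d \o d = 0)%VF ->
    (0 < r)%N ->
    a \in approx_cycles r p q ->
  page_diff (sq_class (page r p q) a)
    = sq_class (page r (p - r%:Z) (q + r%:Z - 1)) (d a).
Proof.
move=> F_mono F_d dd r_gt0 Aa; set S := page r p q.
set S' := page r (p - r%:Z) (q + r%:Z - 1).
have numA (x : W) : x \in approx_cycles r p q -> x \in sq_num S.
  by move=> Ax; apply: subvP x Ax; apply: addvSl.
have dA (x : W) : x \in approx_cycles r p q -> d x \in sq_num S'.
  rewrite memv_cap -memv_preim => /andP[_ Fdx].
  apply: (subvP (addvSl _ _)); rewrite memv_cap -memv_preim.
  have -> : p - r%:Z + (q + r%:Z - 1) = p + q - 1 by ring.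
  by rewrite Fdx -[d (d x)]comp_lfunE dd lfunE mem0v.
rewrite /page_diff -/S -/S'; set s := sq_repr _.
have Ss : s \in sq_num S by apply: sq_repr_num.
have Ab := memv_pi1 (approx_cycles r p q) (F (p - 1) (p + q)) s.
have Fc := memv_pi2 (approx_cycles r p q) (F (p - 1) (p + q)) s.
have s_bc := addv_pi1_pi2 Ss.
set b := addv_pi1 _ _ s in Ab s_bc *; set c := addv_pi2 _ _ s in Fc s_bc.
have /sq_classP := sq_reprK (sq_class S a); rewrite -/s => /(_ Ss (numA _ Aa)) den_sa.
have {den_sa} /memv_addP[_ /memv_imgP[u Au ->] [f Ff saE]] : b - a \in sq_den S.
  have -> : b - a = (s - a) - c by rewrite -s_bc addrAC addrK.
  by apply: rpredB => //; apply: (subvP (addvSr _ _)) Fc.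
apply/sq_classP; [exact: dA | exact: dA |].
have dE : d b - d a = d f.
  by rewrite -linearB saE linearD /= -[d (d u)]comp_lfunE dd lfunE add0r.
rewrite dE; apply: (subvP (addvSl _ _)); apply: memv_img.
have -> : p - r%:Z + r%:Z - 1 = p - 1 by ring.
have -> : q + r%:Z - 1 - r%:Z + 2 = q + 1 by ring.
rewrite memv_cap -memv_preim -dE.
have -> : p - 1 + (q + 1) = p + q by ring.
have -> : p - 1 - (r.-1)%:Z = p - r%:Z by rewrite -[in RHS](prednK r_gt0) -addn1 PoszD; ring.
rewrite Ff; move: Aa Ab; rewrite !memv_cap -!memv_preim => /andP[_ Fa] /andP[_ Fb].
exact: rpredB.
Qed.

End SpectralSequence.

(** * The double complex *)

Section DoubleComplex.
Variable k : nat.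
Local Notation G := 'rV['F_2]_k.
Implicit Types (a b x z : G) (s t : {set G}).

Definition simplex s : bool := free (enum s).

Definition simplices (n : int) : {set {set G}} :=
  [set s : {set G} | simplex s && (#|s|%:Z == n + 1)].

Definition link s : {set {set G}} :=
  [set t : {set G} | [disjoint s & t] && simplex (s :|: t)].

Definition translate s a : {set G} := [set b + a | b in s].

Definition sim s s' : bool :=
  (s == s') || [exists a in s :&: s', s' :\ a == translate (s :\ a) a].

Definition sim_class s : {set {set G}} := [set s' : {set G} | simplex s' && sim s s'].

(* M-valued chains M (x) C_*(X(G_k)), as functions on all subsets of G_k. *)
Definition chain (M : vectType 'F_2) := {ffun {set G} -> M}.

(* the elementary tensor m (x) t *)
Definition elem (M : vectType 'F_2) (m : M) t : chain M :=
  [ffun t' => if t' == t then m else 0].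

Definition boundary (M : vectType 'F_2) (u : chain M) : chain M :=
  \sum_(t : {set G}) \sum_(x in t) elem (u t) (t :\ x).

Local Notation chain2 := (chain (('F_2)^o)%type).
Local Notation elem2 := (@elem (('F_2)^o)%type 1).

Definition c s : chain2 := \sum_(s' in sim_class s) elem2 s'.

(* All E_{p,q} live in one ambient space: the first component holds the columns
   p >= 0, inside C_p(X(G_k)) (x) C_q(X(G_k)), where (s, t) stands for s (x) t;
   the second one holds the column p = -1, inside G_k (x) C_q(X(G_k)). *)
Definition ambient : vectType 'F_2 :=
  ({ffun ({set G} * {set G}) -> ('F_2)^o} * chain G)%type.

Definition tens (u v : chain2) : ambient :=
  ([ffun st => u st.1 * v st.2], 0).

Definition tens_col a t : ambient := (0, elem a t).

Definition E (p q : int) : {vspace ambient} :=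
  if p == -1 then
    if q <= k%:Z - 2 then
      span [seq tens_col a t | a <- enum {: G}, t <- enum (simplices q)]
    else 0%VS
  else
    span [seq tens (c s) (elem2 t) | s <- enum (simplices p),
                                  t <- enum (link s :&: simplices q)].

Definition d_v (w : ambient) : ambient :=
  ([ffun st => boundary [ffun t => w.1 (st.1, t)] st.2], boundary w.2).

Definition class_repr s : {set G} := odflt s [pick s' in sim_class s].

Definition d_h_gen s t : ambient :=
  if [pick a in s] is Some a then
    if #|s| == 1%N then tens_col a t
    else tens (c (translate (s :\ a) a) + \sum_(b in s) c (s :\ b)) (elem2 t)
  else 0.

(* The coefficient of c(s) (x) t in w is read off at (s, t), for s the chosen
   representative of its class; independence of choices is d_h1 and d_hS. *)
Definition d_h (w : ambient) : ambient :=
  \sum_(s : {set G} | simplex s && (class_repr s == s))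
    \sum_(t : {set G}) (w.1 (s, t) : 'F_2) *: d_h_gen s t.

Fact elem_linear (M : vectType 'F_2) t : linear (fun m : M => elem m t).
Proof.
by move=> l m n; apply/ffunP=> t'; rewrite !ffunE; case: ifP; rewrite ?scaler0 ?addr0.
Qed.

Fact boundary_linear (M : vectType 'F_2) : linear (@boundary M).
Proof.
move=> l u v; rewrite /boundary scaler_sumr -big_split; apply: eq_bigr => t _ /=.
rewrite scaler_sumr -big_split; apply: eq_bigr => x _ /=.
by rewrite !ffunE elem_linear.
Qed.

Fact d_v_linear : linear d_v.
Proof.
move=> l u v; congr pair; rewrite /= ?boundary_linear //.
apply/ffunP=> st; rewrite !ffunE /=.
set f := [ffun t => _]; set g := [ffun t => _]; set h := [ffun t => _].
have -> : f = l *: (g : chain2) + h by apply/ffunP=> t; rewrite !ffunE.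
by rewrite boundary_linear !ffunE.
Qed.
HB.instance Definition _ :=
  GRing.isLinear.Build 'F_2 ambient ambient *:%R d_v d_v_linear.

Fact d_h_linear : linear d_h.
Proof.
move=> l u v; rewrite /d_h scaler_sumr -big_split; apply: eq_bigr => s _ /=.
rewrite scaler_sumr -big_split; apply: eq_bigr => t _ /=.
by rewrite !ffunE /= scalerDl scalerA.
Qed.
HB.instance Definition _ :=
  GRing.isLinear.Build 'F_2 ambient ambient *:%R d_h d_h_linear.

Definition d_tot : 'End(ambient) := (linfun d_h + linfun d_v)%VF.

(* the part of the total complex of degree n in column p *)
Definition tot_col (p n : int) : {vspace ambient} := E p (n - p).

Definition column (i : 'I_k.+1) : int := i%:Z - 1.

Definition tot (n : int) : {vspace ambient} :=
  (\sum_(i < k.+1) tot_col (column i) n)%VS.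

(* filtration by columns *)
Definition filt (p n : int) : {vspace ambient} :=
  (\sum_(i < k.+1 | (column i <= p)%R) tot_col (column i) n)%VS.

Definition E_page (r : nat) (p q : int) : subquot ambient :=
  page filt d_tot r p q.

Definition E_infty (p q : int) : subquot ambient :=
  page_infty filt tot d_tot p q.

Definition E_diff (r : nat) (p q : int) (x : E_page r p q) :
    E_page r (p - r%:Z) (q + r%:Z - 1) :=
  page_diff x.

(** ** The defining formulas of d_v and d_h *)

Lemma boundary_elem (M : vectType 'F_2) (m : M) t :
  boundary (elem m t) = \sum_(x in t) elem m (t :\ x).
Proof.
have elem0 t' : elem (0 : M) t' = 0.
  by apply/ffunP=> ?; rewrite !ffunE; case: ifP.
rewrite /boundary (bigD1 t) //= ffunE eqxx [X in _ + X]big1 ?addr0 // => t' /negPf ne_t.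
by rewrite big1 // => x _; rewrite ffunE ne_t.
Qed.

Lemma d_v_tens (u v : chain2) : d_v (tens u v) = tens u (boundary v).
Proof.
congr pair; last first.
  rewrite /= /boundary big1 // => t _; rewrite big1 // => x _.
  by apply/ffunP=> ?; rewrite !ffunE; case: ifP.
apply/ffunP=> st; rewrite !ffunE /=.
have -> : [ffun t => [ffun st0 => u st0.1 * v st0.2] (st.1, t)] = (u st.1 : 'F_2) *: v.
  by apply/ffunP=> t; rewrite !ffunE.
by rewrite -[X in boundary X]addr0 boundary_linear !ffunE
     [boundary 0]big1 ?ffunE ?addr0 // => t _; rewrite big1 // => x _;
   apply/ffunP=> ?; rewrite !ffunE; case: ifP.
Qed.

Lemma d_v_tens_col a t : d_v (tens_col a t) = \sum_(x in t) tens_col a (t :\ x).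
Proof.
pose f (w : chain G) : ambient := (0, w).
have f_lin : linear f by move=> l u v; congr pair; rewrite /= scaler0 addr0.
pose F := HB.pack_for {linear chain G -> ambient} f
  (GRing.isLinear.Build _ _ _ _ f f_lin).
transitivity (F (boundary (elem a t))); last first.
  by rewrite boundary_elem linear_sum.
congr pair; apply/ffunP=> st; rewrite !ffunE /boundary big1 ?ffunE // => t' _.
by rewrite big1 // => x _; apply/ffunP=> ?; rewrite !ffunE; case: ifP.
Qed.

Lemma simplex_neq0 s a : simplex s -> a \in s -> a != 0.
Proof. by move=> /free_not0 free_s sa; apply: free_s; rewrite mem_enum. Qed.

Lemma simplexN0 s : simplex s -> 0 \notin s.
Proof. by move=> sS; apply/negP=> /(simplex_neq0 sS); rewrite eqxx. Qed.

Lemma addGG a : a + a = 0.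
Proof. by rewrite -mulr2n -scaler_nat pchar_Zp // scale0r. Qed.

Lemma addGGK a : involutive (+%R^~ a).
Proof. by move=> b /=; rewrite -addrA addGG addr0. Qed.

Lemma addG_eq0 a b : (a + b == 0) = (a == b).
Proof. by rewrite -(inj_eq (inv_inj (addGGK b))) addGGK add0r. Qed.

Lemma addG_eq a b : (a + b == b) = (a == 0).
Proof. by rewrite -(inj_eq (inv_inj (addGGK b))) addGGK addGG. Qed.

Lemma mem_translate s a b : (b \in translate s a) = (b + a \in s).
Proof.
apply/imsetP/idP=> [[x sx ->]|sba]; first by rewrite addGGK.
by exists (b + a); rewrite ?addGGK.
Qed.

(* A simplex s stands for the affine simplex 0 |: s; sim is then translation. *)
Lemma simP s s' : 0 \notin s -> 0 \notin s' ->
  reflect (exists z, 0 |: s' = translate (0 |: s) z) (sim s s').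
Proof.
move=> s0 s'0; apply: (iffP idP) => [/orP[/eqP <-|]|[z]].
- by exists 0; apply/setP=> x; rewrite mem_translate addr0.
- case/exists_inP=> a; rewrite inE => /andP[sa s'a] /eqP/setP E_s'.
  exists a; apply/setP=> x; have := E_s' x.
  rewrite mem_translate !inE mem_translate !inE addG_eq0 addG_eq.
  have [->|ne_xa] /= := eqVneq x a; first by rewrite s'a orbT.
  by have [->|] //= := eqVneq x 0; rewrite ?add0r ?sa.
move=> /setP E_s'; have [z0|z_neq0] := eqVneq z 0.
  apply/orP; left; apply/eqP/setP=> x; have := E_s' x.
  rewrite mem_translate !inE z0 addr0.
  by have [->|] //= := eqVneq x 0; rewrite (negPf s0) (negPf s'0).
have sz : z \in s.
  have := E_s' 0; rewrite mem_translate !inE eqxx add0r (negPf z_neq0) /=.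
  by move=> <-.
have s'z : z \in s'.
  have := E_s' z; rewrite mem_translate !inE addGG eqxx (negPf z_neq0) /=.
  by move=> ->.
apply/orP; right; apply/exists_inP; exists z; first by rewrite inE sz.
apply/eqP/setP=> x; have := E_s' x.
rewrite mem_translate !inE mem_translate !inE addG_eq0 addG_eq.
have [->|ne_xz] /= := eqVneq x z; first by rewrite addGG (negPf s0) andbF.
by have [->|] //= := eqVneq x 0; rewrite (negPf s'0).
Qed.

Lemma translateD s a b : translate (translate s a) b = translate s (a + b).
Proof. by apply/setP=> x; rewrite !mem_translate -addrA [b + a]addrC. Qed.

Lemma translate0 s : translate s 0 = s.
Proof. by apply/setP=> x; rewrite mem_translate addr0. Qed.

Lemma eq_c s s' z : 0 \notin s -> 0 \notin s' ->
  0 |: s' = translate (0 |: s) z -> c s' = c s.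
Proof.
move=> s0 s'0 E_s'; apply: eq_bigl => s''; rewrite !inE.
apply/andP/andP=> -[s''_s]; have s''0 : 0 \notin s''.
- exact: simplexN0.
- case/(simP s'0 s''0)=> y E_s''; split=> //; apply/(simP s0 s''0).
  by exists (z + y); rewrite E_s'' E_s' translateD.
- exact: simplexN0.
case/(simP s0 s''0)=> y E_s''; split=> //; apply/(simP s'0 s''0).
by exists (z + y); rewrite E_s'' E_s' translateD addrA addGG add0r.
Qed.

(* c of the face omitting a vertex of an affine simplex, moved to the origin *)
Definition c_aff (A : {set G}) : chain2 :=
  c (translate A (odflt 0 [pick x in A]) :\ 0).

Lemma c_affE (A : {set G}) s z : 0 \notin s -> 0 |: s = translate A z -> c s = c_aff A.
Proof.
move=> s0 /setP E_s; rewrite /c_aff; case: pickP => [b Ab|A0]; last first.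
  by have := E_s 0; rewrite mem_translate A0 !inE eqxx.
apply: (@eq_c _ _ (b + z)); rewrite ?inE ?eqxx //.
rewrite setD1K ?mem_translate ?add0r // translateD addrA addGG add0r.
by apply/setP.
Qed.

Definition d_h_sum s : chain2 := \sum_(x in 0 |: s) c_aff ((0 |: s) :\ x).

Lemma d_h_sumE s a : simplex s -> a \in s ->
  c (translate (s :\ a) a) + \sum_(b in s) c (s :\ b) = d_h_sum s.
Proof.
move=> sS sa; have s0 := simplexN0 sS.
rewrite /d_h_sum big_setU1 //=; congr (_ + _).
  apply: (@c_affE _ _ a); first by rewrite mem_translate add0r !inE eqxx.
  apply/setP=> x; rewrite !inE !mem_translate !inE addG_eq addG_eq0.
  have [->|ne_x0] /= := eqVneq x 0.
    by rewrite add0r sa orbT andbT eq_sym (simplex_neq0 sS sa).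
  by have [->|] //= := eqVneq x a; rewrite addGG (negPf s0).
apply: eq_bigr => b sb; apply: (@c_affE _ _ 0); first by rewrite !inE negb_and s0 orbT.
rewrite translate0; apply/setP=> x; rewrite !inE.
by have [->|] //= := eqVneq x 0; rewrite eq_sym (simplex_neq0 sS sb).
Qed.

Lemma c_aff_translate (A : {set G}) z : c_aff (translate A z) = c_aff A.
Proof.
have [->|[b Ab]] := set_0Vmem A.
  by congr c_aff; apply/setP=> x; rewrite mem_translate !inE.
pose s := translate A b :\ 0.
have E_s : 0 |: s = translate A b by rewrite setD1K // mem_translate add0r.
rewrite -(@c_affE A s b) ?inE ?eqxx //.
apply/esym/(@c_affE _ _ (z + b)); rewrite ?inE ?eqxx //.
by rewrite E_s translateD addrA addGG add0r.
Qed.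

Lemma d_h_sum_sim s s' : simplex s -> simplex s' -> sim s s' ->
  d_h_sum s' = d_h_sum s.
Proof.
move=> sS s'S /(simP (simplexN0 sS) (simplexN0 s'S))[z E_s'].
rewrite /d_h_sum E_s' (reindex_inj (inv_inj (addGGK z))) /=.
apply: eq_big => [x|x _]; first by rewrite mem_translate addGGK.
rewrite -[RHS](c_aff_translate _ z); congr c_aff; apply/setP=> y.
by rewrite !(inE, mem_translate) -(inj_eq (inv_inj (addGGK z))) addGGK.
Qed.

Lemma simplex_class s s' : s' \in sim_class s -> simplex s'.
Proof. by rewrite inE => /andP[]. Qed.

Lemma sim_class_eq s s' : simplex s -> s' \in sim_class s ->
  sim_class s' = sim_class s.
Proof.
move=> sS /[dup] /simplex_class s'S; rewrite inE => /andP[_].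
have [s0 s'0] := (simplexN0 sS, simplexN0 s'S).
case/(simP s0 s'0)=> z E_s'; apply/setP=> r; rewrite !inE.
have [/simplexN0 r0|//] := boolP (simplex r).
apply/(simP s'0 r0)/(simP s0 r0) => -[y ->].
  by exists (z + y); rewrite E_s' translateD.
by exists (z + y); rewrite E_s' translateD addrA addGG add0r.
Qed.

Lemma mem_sim_class s : simplex s -> s \in sim_class s.
Proof. by move=> sS; rewrite inE sS /sim eqxx. Qed.

Lemma class_reprP s : simplex s -> class_repr s \in sim_class s.
Proof.
move=> sS; rewrite /class_repr; case: pickP => [//|/(_ s)].
by rewrite mem_sim_class.
Qed.

Lemma class_repr_eq s r : simplex s -> r \in sim_class s ->
  class_repr r = class_repr s.
Proof.
move=> sS sr; rewrite /class_repr (sim_class_eq sS sr); case: pickP => //.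
by move=> /(_ s); rewrite mem_sim_class.
Qed.

Lemma cE s r : c s r = (r \in sim_class s)%:R.
Proof.
rewrite /c sum_ffunE; have [sr|s'r] := boolP (r \in sim_class s).
  rewrite (bigD1 r) //= ffunE eqxx big1 ?addr0 // => r' /andP[_ ne_r].
  by rewrite ffunE eq_sym (negPf ne_r).
rewrite big1 // => r' sr'; rewrite ffunE; case: eqP => // r_r'.
by rewrite r_r' sr' in s'r.
Qed.

Lemma sum_pick2 (U : lmodType 'F_2) (I J : finType) (P Q : pred I) (i : I) (j : J)
    (g : I -> J -> U) :
  P i && Q i -> (forall i', P i' -> i' != i -> Q i' = false) ->
  \sum_(i' | P i') \sum_j' (Q i' && (j' == j))%:R *: g i' j' = g i j.
Proof.
case/andP=> Pi Qi Q_i; rewrite (bigD1 i) //= (bigD1 j) //= Qi eqxx scale1r.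
rewrite big1 => [|j' /negPf ->]; last by rewrite scale0r.
rewrite big1 ?addr0 // => i' /andP[Pi' /(Q_i _ Pi') ->].
by rewrite big1 // => j' _; rewrite scale0r.
Qed.

Lemma d_hE s t : simplex s ->
  d_h (tens (c s) (elem2 t)) = d_h_gen (class_repr s) t.
Proof.
move=> sS; have sr := class_reprP sS; have rS := simplex_class sr.
have cf r t' : (tens (c s) (elem2 t)).1 (r, t') =
    ((r \in sim_class s) && (t' == t))%:R :> 'F_2.
  rewrite [LHS]ffunE [in LHS]cE [X in _ * X]ffunE /=.
  by case: (r \in _); case: (t' == t); rewrite ?mul1r ?mul0r.
rewrite /d_h; under eq_bigr do under eq_bigr do rewrite cf.
apply: sum_pick2; first by rewrite rS (class_repr_eq sS sr) eqxx sr.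
move=> r /andP[_ /eqP r_r]; apply: contraNF => rC.
by rewrite -r_r (class_repr_eq sS rC).
Qed.

Lemma card_sim s s' : simplex s -> s' \in sim_class s -> #|s'| = #|s|.
Proof.
move=> sS /[dup] /simplex_class s'S; rewrite inE => /andP[_].
have [s0 s'0] := (simplexN0 sS, simplexN0 s'S).
case/(simP s0 s'0)=> z /(congr1 (fun A : {set G} => #|A|)).
rewrite card_imset; last exact/inv_inj/addGGK.
by rewrite !cardsU1 s0 s'0 => -[].
Qed.

Lemma d_h1 a t : a != 0 -> d_h (tens (c [set a]) (elem2 t)) = tens_col a t.
Proof.
move=> a_neq0; have aS : simplex [set a].
  by rewrite /simplex enum_set1 seq1_free.
rewrite d_hE //; have := class_reprP aS; set r := class_repr _ => ar.
have r1 := card_sim aS ar; have rS := simplex_class ar.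
have -> : r = [set a].
  move/eqP: r1; rewrite cards1 => /cards1P[b r_b]; rewrite r_b in ar *.
  move: ar; rewrite inE => /andP[_ /orP[/eqP//|/exists_inP[x]]].
  by rewrite !inE => /andP[/eqP -> /eqP ->].
rewrite /d_h_gen cards1; case: pickP => [b|/(_ a)]; last by rewrite inE eqxx.
by rewrite inE => /eqP ->.
Qed.

Lemma d_hS s a t : simplex s -> (1 < #|s|)%N -> a \in s ->
  d_h (tens (c s) (elem2 t)) =
    tens (c (translate (s :\ a) a) + \sum_(b in s) c (s :\ b)) (elem2 t).
Proof.
move=> sS s_gt1 sa; have sr := class_reprP sS; have rS := simplex_class sr.
rewrite d_hE // d_h_sumE // /d_h_gen; case: pickP => [b rb|r_eq0]; last first.
  by move: s_gt1; rewrite -(card_sim sS sr) eq_card0.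
rewrite (card_sim sS sr) gtn_eqF // d_h_sumE // (d_h_sum_sim sS) //.
by move: sr; rewrite inE => /andP[].
Qed.

End DoubleComplex.

(* Main.v *)
From HB Require Import structures.
Require Import Defs.
From mathcomp Require Import all_boot all_order all_algebra zify.
Import Order.TTheory GRing.Theory Num.Theory.
Local Open Scope ring_scope.

Set Implicit Arguments.
Unset Strict Implicit.
Unset Printing Implicit Defensive.

(** Write X for the complex of independent subsets of G = F_2^k.

Columns. The link of an independent set s is the independence complex of a
matroid of rank k - #|s|, so its reduced homology sits in its top degree
([link_acyclic], by deletion and contraction of one vertex at a time). Hence
the column p >= 0 of the double complex has vertical homology only in total
degree k - 2 ([column_exact]). The column p = -1 is G tensored with the
(k - 2)-skeleton of X; its homology sits in total degree k - 3, and its cycles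
there are the boundaries of (k - 1)-chains of X, because X itself is acyclic
below degree k - 1 ([col_cycle]). From E^1 on, the only
differentials between nonzero terms therefore go into the place (-1, k - 2).

Surjectivity of d^2. The cycles at that place are spanned by the tensors
a (x) dS, where S is a basis of G and a lies in S. Put T = S \ a and let p be
the sum of T. Every proper subset of T stays independent modulo p, and modulo
a and p together, so dT is a cycle in the link of the edge {a, p}. The identity

  a (x) dS = d (c{a, p} (x) dT + c{a} (x) T + (c{p} + c{a + p}) (x) (dS - T))

exhibits a (x) dS as the boundary of a chain of filtration 1 whose
column 1 component c{a, p} (x) dT is a vertical cycle, that is, as a value
of d^2 ([basis_boundary_hit], [col_cycle_bounds]).

Degeneration. Together these facts say that a cycle of filtration m, in any
total degree but k - 2, is the boundary of a chain of filtration m + 2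
([cycle_bounds]); in total degree k - 1 there is nothing to bound, as the total
complex stops in degree k - 2 ([tot_top]). A differential d^r with r >= 3 lowers
the filtration by three or more, so its values already bound chains that are
divided out in its target. The same bound on the filtration shift gives both
halves of E^3 = E^infinity: numerators, since a chain whose boundary drops by 3
is a cycle up to lower filtration, and denominators, since every boundary of
filtration p bounds a chain of filtration p + 2. *)

(** * Chains over F_2 and cones *)

Lemma F2_addvv (L : lmodType 'F_2) (v : L) : v + v = 0.
Proof. by rewrite -mulr2n -scaler_nat pchar_Zp // scale0r. Qed.

Lemma F2_oppv (L : lmodType 'F_2) (v : L) : - v = v.
Proof. by apply/esym/eqP; rewrite -addr_eq0 F2_addvv. Qed.

(** In characteristic 2 the terms (i, j) and (j, i) cancel; every double
boundary below vanishes for this reason. *)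
Lemma sum_sym0 (L : lmodType 'F_2) (I : finType) (P : rel I) (F : I -> I -> L) :
    symmetric P -> irreflexive P -> (forall i j, F i j = F j i) ->
  \sum_(xy : I * I | P xy.1 xy.2) F xy.1 xy.2 = 0.
Proof.
move=> P_sym P_irr F_sym; have swapK : involutive (fun xy : I * I => (xy.2, xy.1)) by case.
pose lt (xy : I * I) := (enum_rank xy.1 < enum_rank xy.2)%N.
rewrite (bigID lt) /= [X in _ + X](reindex_inj (inv_inj swapK)) /=.
rewrite [X in _ + X](eq_big (fun xy => P xy.1 xy.2 && lt xy)
   (fun xy : I * I => F xy.1 xy.2)) ?F2_addvv // => -[i j] /=.
rewrite P_sym /lt /= -leqNgt leq_eqVlt.
rewrite [in LHS](inj_eq val_inj) (inj_eq enum_rank_inj).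
by case: eqP => [->|] //=; rewrite P_irr.
Qed.

Section Chains.
Variables (k : nat) (M : vectType 'F_2).
Local Notation G := 'rV['F_2]_k.
Implicit Types (a b e x : G) (s t V : {set G}) (u z w : chain k M).

HB.instance Definition _ :=
  GRing.isLinear.Build 'F_2 (chain k M) (chain k M) *:%R (@boundary k M)
    (@boundary_linear k M).

Lemma boundaryE u t : boundary u t = \sum_(x | x \notin t) u (x |: t).
Proof.
rewrite /boundary sum_ffunE.
under eq_bigr do rewrite sum_ffunE.
rewrite (exchange_big_dep xpredT) //= [RHS]big_mkcond /=.
apply: eq_bigr => x _; case: ifPn => [t'x|/negbNE tx].
  rewrite (bigD1 (x |: t)) ?setU11 //= ffunE setU1K // eqxx big1 ?addr0 //.
  move=> t' /andP[xt' /negPf ne_t]; rewrite ffunE; case: eqP => // E_t.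
  by rewrite E_t setD1K ?eqxx in ne_t.
rewrite big1 // => t' xt'; rewrite ffunE; case: eqP => // E_t.
by rewrite E_t !inE eqxx in tx.
Qed.

Lemma boundary2 u : boundary (boundary u) = 0.
Proof.
apply/ffunP=> t; rewrite boundaryE ffunE.
under eq_bigr do rewrite boundaryE.
rewrite pair_big_dep /=.
rewrite (eq_bigl (fun xy : G * G => [&& xy.1 \notin t, xy.2 \notin t & xy.1 != xy.2])).
  apply: (@sum_sym0 _ _ (fun x y => [&& x \notin t, y \notin t & x != y])
    (fun x y => u (y |: (x |: t)))) => [x y|x|x y]; first by rewrite eq_sym andbCA.
    by rewrite eqxx !andbF.
  by rewrite setUCA.
by move=> [x y] /=; rewrite !inE negb_or andbA [y == x]eq_sym andbAC andbA.
Qed.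

(** The join with the vertex e; the simplices that contain e are sent to 0. *)
Definition cone e u : chain k M := [ffun t : {set G} => if e \in t then u (t :\ e) else 0].

(** The cone is a contracting homotopy on all chains, also on those that
involve e, with no sign since the coefficients have characteristic 2. *)
Lemma boundary_cone e u : boundary (cone e u) = u + cone e (boundary u).
Proof.
apply/ffunP=> t; rewrite boundaryE !ffunE; have [te|t'e] := boolP (e \in t).
  have D x : x \notin t -> (x |: t) :\ e = x |: (t :\ e).
    move=> t'x; apply/setP=> y; rewrite !inE; case: (y =P x) => [->|_] //=.
    by rewrite andbT; apply: contraNneq t'x => ->.
  rewrite boundaryE [X in _ = _ + X](bigD1 e) ?inE ?eqxx //= setD1K // addrA F2_addvv add0r.
  apply: eq_big => [x|x t'x]; last by rewrite ffunE D // !inE te orbT.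
  by rewrite !inE negb_and negbK; case: eqP => [->|] //=; rewrite ?te ?andbT.
rewrite (bigD1 e) //= ffunE setU11 setU1K // big1 => [|x /andP[t'x ne_xe]].
  by rewrite !addr0.
by rewrite ffunE !inE (negPf t'e) eq_sym (negPf ne_xe).
Qed.

Lemma chainE u : u = \sum_t elem (u t) t.
Proof.
apply/ffunP=> t; rewrite sum_ffunE (bigD1 t) //= ffunE eqxx.
by rewrite big1 ?addr0 // => t' /negPf ne_t; rewrite ffunE eq_sym ne_t.
Qed.

Definition supp (P : pred {set G}) u := forall t, u t != 0 -> P t.

Lemma suppD P u w : supp P u -> supp P w -> supp P (u + w).
Proof.
move=> Pu Pw t; rewrite ffunE; have [->|/Pu //] := eqVneq (u t) 0.
by rewrite add0r => /Pw.
Qed.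

Lemma suppW (P Q : pred {set G}) u : subpred P Q -> supp P u -> supp Q u.
Proof. by move=> PQ Pu t /Pu/PQ. Qed.

End Chains.

(** * Spans and links *)

Section Links.
Variable k : nat.
Local Notation G := 'rV['F_2]_k.
Implicit Types (a b e x : G) (s t V : {set G}).

Definition set_span s : {vspace G} := <<enum s>>%VS.

Lemma mem_set_span s x : x \in s -> x \in set_span s.
Proof. by move=> sx; rewrite memv_span // mem_enum. Qed.

Lemma set_span_sub s (U : {vspace G}) : {in s, forall x, x \in U} -> (set_span s <= U)%VS.
Proof. by move=> sU; apply/span_subvP=> x; rewrite mem_enum => /sU. Qed.

Lemma set_spanS s t : s \subset t -> (set_span s <= set_span t)%VS.
Proof. by move=> /subsetP st; apply: set_span_sub => x /st/mem_set_span. Qed.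

Lemma simplexE s : simplex s = (\dim (set_span s) == #|s|).
Proof. by rewrite /simplex /free cardE. Qed.

Lemma dim_set_span s : (\dim (set_span s) <= #|s|)%N.
Proof. by rewrite cardE dim_span. Qed.

Lemma simplex_sub s t : s \subset t -> simplex t -> simplex s.
Proof.
move=> st; rewrite /simplex => ft; apply: (@catl_free _ _ (enum (t :\: s))).
rewrite (perm_free (Y := enum t)) //; apply: uniq_perm; rewrite ?enum_uniq //.
  rewrite cat_uniq !enum_uniq andbT /=; apply/hasPn=> x.
  by rewrite !mem_enum inE => /andP[].
move=> x; rewrite mem_cat !mem_enum inE.
by have [/(subsetP st) ->|] := boolP (x \in s).
Qed.

(** Disjointness and independence in one numerical condition, which depends on
s only through its span and its size. *)
Lemma linkE s t : (t \in link s) = (\dim (set_span (s :|: t)) == #|s| + #|t|)%N.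
Proof.
rewrite inE simplexE -leq_card_setU; have := dim_set_span (s :|: t).
have := (leq_card_setU s t).1; case: (ltngtP #|s :|: t| (#|s| + #|t|)) => //=.
  by move=> lt_st _ /leq_ltn_trans/(_ lt_st)/ltn_eqF ->.
by move=> ->.
Qed.

Lemma dim_set_span_leq s : (\dim (set_span s) <= k)%N.
Proof. by apply: leq_trans (dimvS (subvf _)) _; rewrite dimvf dim_matrix mul1r. Qed.

Lemma set_span_absorb s e : e \in set_span s -> set_span (e |: s) = set_span s.
Proof.
move=> se; apply/eqP; rewrite eqEsubv [X in _ && X]set_spanS ?subsetUr // andbT.
by apply: set_span_sub => x; rewrite in_setU1 => /predU1P[->|/mem_set_span].
Qed.

(** [set_span_absorb] and this lemma are the two cases, loop and non-loop, of a
vertex of a matroid contracted by s. *)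
Lemma dim_set_span_grow s e : e \notin set_span s ->
  \dim (set_span (e |: s)) = (\dim (set_span s)).+1.
Proof.
move=> s'e; have -> : set_span (e |: s) = (<[e]> + set_span s)%VS.
  apply/eqP; rewrite eqEsubv; apply/andP; split.
    apply: set_span_sub => x; rewrite in_setU1 => /predU1P[->|/mem_set_span sx].
      by apply: (subvP (addvSl _ _)); apply: memv_line.
    exact: (subvP (addvSr _ _)).
  by rewrite subv_add -memvE mem_set_span ?setU11 // set_spanS // subsetUr.
have e_neq0 : e != 0 by apply: contraNneq s'e => ->; rewrite mem0v.
rewrite dimv_disjoint_sum ?dim_vline ?e_neq0 //; apply/eqP; rewrite -subv0.
apply/subvP=> x; rewrite memv_cap => /andP[/vlineP[l ->]].
have [->|l_neq0] := eqVneq l 0; first by rewrite scale0r !mem0v.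
by rewrite rpredZeq (negPf l_neq0) (negPf s'e).
Qed.

Lemma set_spanU s t : set_span (s :|: t) = (set_span s + set_span t)%VS.
Proof.
apply/eqP; rewrite eqEsubv; apply/andP; split.
  apply: set_span_sub => x; rewrite inE => /orP[/mem_set_span sx|/mem_set_span tx].
    exact: (subvP (addvSl _ _)).
  exact: (subvP (addvSr _ _)).
by rewrite subv_add !set_spanS ?subsetUl ?subsetUr.
Qed.

Lemma link_eq s s' : set_span s' = set_span s -> #|s'| = #|s| -> link s' = link s.
Proof. by move=> E_s E_c; apply/setP=> t; rewrite !linkE !set_spanU E_s E_c. Qed.

Lemma linkS s s' : s' \subset s -> link s \subset link s'.
Proof.
move=> s's; apply/subsetP=> t; rewrite !inE => /andP[s_t st].
by rewrite (disjointWl s's) // (simplex_sub _ st) // setSU.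
Qed.

Lemma card_link s t : t \in link s -> (#|s| + #|t| <= k)%N.
Proof. by rewrite linkE => /eqP <-; apply: dim_set_span_leq. Qed.

Lemma link_face_sub s t x : t \in link s -> t :\ x \in link s.
Proof.
rewrite !inE => /andP[s_t stS]; rewrite (simplex_sub _ stS) ?setUS ?subD1set //.
by rewrite andbT; apply: disjointWr s_t; apply: subD1set.
Qed.

Lemma link_simplex s t : t \in link s -> simplex s /\ simplex t.
Proof.
by rewrite inE => /andP[_ st]; split; apply: simplex_sub st; rewrite ?subsetUl ?subsetUr.
Qed.

Lemma dim_set_spanT : \dim (set_span [set: G]) = k.
Proof.
rewrite (_ : set_span setT = fullv); first by rewrite dimvf dim_matrix mul1r.
by apply/eqP; rewrite eqEsubv subvf; apply/subvP=> x _; rewrite mem_set_span ?inE.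
Qed.

End Links.

(** * Acyclicity of links below their top degree *)

Section Acyclicity.
Variables (k : nat) (M : vectType 'F_2).
Local Notation G := 'rV['F_2]_k.
Implicit Types (e : G) (s t V : {set G}) (z w : chain k M).

(** The faces of the link of s inside the vertex set V, graded by the total
size n = #|s| + #|t|: moving a vertex from t to s, as contraction does, keeps
this grading. *)
Definition link_face V s (n : nat) : pred {set G} :=
  [pred t : {set G} | [&& t \subset V, t \in link s & (#|s| + #|t| == n)%N]].

(** Deletion and contraction of a vertex e of V = e |: V'. If e is outside the
span of s and V' (a coloop), the complex is a cone with apex e. Otherwise
deleting e keeps the rank; the part of z containing e is a cycle in the link of
e |: s, hence bounds some w1 there, and adding the boundary of the cone over w1
pushes z off e. The set s is allowed to be dependent, in which case the link is
empty; this spares a separate treatment of loops. *)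
Lemma link_acyclic V s n z : (n < \dim (set_span (s :|: V)))%N ->
    supp (link_face V s n) z -> boundary z = 0 ->
  exists2 w, supp (link_face V s n.+1) w & boundary w = z.
Proof.
move: {2}_.+1 (ltnSn #|V|) => m; elim: m => // m IH in V s n z *.
rewrite ltnS; have [->|[e Ve]] := set_0Vmem V => Vm n_lt z_face dz.
  exists 0 => [t|]; first by rewrite ffunE eqxx.
  rewrite linear0; apply/ffunP=> t; rewrite ffunE; apply/esym/eqP/contraT.
  case/z_face/and3P=> _ _ /eqP n_eq; move: n_lt.
  by rewrite setU0 ltnNge -n_eq (leq_trans (dim_set_span s)) ?leq_addr.
set V' := V :\ e; have V_eq : V = e |: V' by rewrite setD1K.
have V'm : (#|V'| < m)%N by rewrite (leq_trans _ Vm) // [in X in (_ < X)%N](cardsD1 e) Ve.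
have V'V : V' \subset V by apply: subD1set.
have faceW s' n' : subpred (link_face V' s' n') (link_face V s' n').
  by move=> t /and3P[tV' ? ?]; apply/and3P; split=> //; apply: subset_trans tV' V'V.
have dimE : e \in set_span (s :|: V') -> \dim (set_span (s :|: V)) = \dim (set_span (s :|: V')).
  by move=> Ue; rewrite V_eq setUCA set_span_absorb.
have subV' t : t \subset V -> e \notin t -> t \subset V'.
  by move=> tV t'e; rewrite subsetD1 tV.
have [Ue|U'e] := boolP (e \in set_span (s :|: V')); last first.
  exists (cone e z); last by rewrite boundary_cone dz; apply/ffunP=> t;
    rewrite !ffunE; case: ifP; rewrite ?ffunE addr0.
  move=> t; rewrite ffunE; case: ifP => [te|_ /eqP//] /z_face/and3P[tV ts n_eq].
  have cardt : (#|t| = #|t :\ e|.+1)%N by rewrite (cardsD1 e) te.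
  apply/and3P; split.
  - rewrite -(setD1K te) subUset sub1set Ve.
    exact: tV.
  - have U_eq : s :|: t = e |: (s :|: t :\ e) by rewrite setUCA setD1K.
    move: ts; rewrite !linkE U_eq dim_set_span_grow.
      by rewrite cardt addnS eqSS.
    apply: contra U'e; apply/subvP/set_spanS/setUS/subV' => //.
    by rewrite !inE eqxx.
  - by rewrite cardt addnS eqSS.
pose z1 : chain k M := [ffun t : {set G} => if e \in t then 0 else z (e |: t)].
have dz1 : boundary z1 = 0.
  apply/ffunP=> t; rewrite boundaryE ffunE; have [te|t'e] := boolP (e \in t).
    by rewrite big1 // => x _; rewrite ffunE !inE te orbT.
  have /ffunP/(_ (e |: t)) := dz; rewrite boundaryE ffunE => dzt.
  rewrite -[RHS]dzt (bigD1 e) //= ffunE setU11 add0r.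
  apply: eq_big => [x|x /andP[t'x ne_xe]]; first by rewrite !inE negb_or andbC.
  by rewrite ffunE !inE eq_sym (negPf ne_xe) (negPf t'e) setUCA.
(* the case e in s, where no face contains e, needs w1 = 0: the clause
   e \notin s records that w1 vanishes then *)
have [w1 w1_face dw1] : exists2 w1,
    supp [pred t : {set G} | (e \notin s) && link_face V' (e |: s) n.+1 t] w1 &
    boundary w1 = z1.
  have [se|s'e] := boolP (e \in s).
    exists 0 => [t|]; first by rewrite ffunE eqxx.
    rewrite linear0; apply/ffunP=> t; rewrite !ffunE; case: ifP => // _.
    apply/esym/eqP/contraT=> /z_face/and3P[_]; rewrite inE.
    by case/andP=> /disjointFr/(_ se); rewrite setU11.
  suff [w1 w1_face dw1] : exists2 w1, supp (link_face V' (e |: s) n.+1) w1 &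
      boundary w1 = z1 by exists w1.
  apply: IH => //; first by rewrite -setUA setUCA -V_eq.
  move=> t; rewrite ffunE; case: ifPn => [_ /eqP//|t'e].
  case/z_face/and3P=> tV ts n_eq.
  have cards : (#|e |: s| + #|t| = #|s| + #|e |: t|)%N.
    by rewrite !cardsU1 s'e t'e addnCA addnA.
  apply/and3P; split; last by rewrite cards.
    by apply: subV' t'e; apply: subset_trans tV; apply: subsetUr.
  by move: ts; rewrite !linkE -setUA setUCA cards.
pose z' := z + boundary (cone e w1).
have w1_e t : e \in t -> w1 t = 0.
  move=> te; apply/eqP/contraT=> /w1_face/andP[_ /and3P[/subsetP/(_ e te)]].
  by rewrite !inE eqxx.
have w1_link t : w1 t != 0 -> link_face V s n.+1 (e |: t) /\ link_face V' s n t.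
  move=> /[dup] w1t /w1_face/andP[s'e /and3P[tV' ts n_eq]].
  have t'e : e \notin t by apply: contraNN w1t => /w1_e ->.
  move: ts n_eq; rewrite linkE !cardsU1 s'e !add1n !addSn eqSS => ts n_eq.
  have cardet : #|e |: t| = #|t|.+1 by rewrite cardsU1 t'e.
  split; apply/and3P; split=> //.
  - by rewrite subUset sub1set Ve (subset_trans tV').
  - by rewrite linkE setUCA setUA cardet addnS.
  - by rewrite cardet addnS eqSS.
  rewrite linkE eqn_leq (leq_trans (dim_set_span _)) ?(leq_card_setU _ _).1 //=.
  rewrite -ltnS -(eqP ts) -setUA.
  have [te|/dim_set_span_grow -> //] := boolP (e \in set_span (s :|: t)).
  by rewrite set_span_absorb.
have [w0 w0_face dw0] : exists2 w0, supp (link_face V' s n.+1) w0 & boundary w0 = z'.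
  apply: IH => //; first by rewrite -dimE.
    move=> t; have [te|t'e] := boolP (e \in t).
      rewrite /z' boundary_cone dw1 !ffunE te !inE eqxx /= setD1K // w1_e //.
      by rewrite add0r F2_addvv eqxx.
    rewrite /z' boundary_cone !ffunE (negPf t'e) addr0.
    have [->|/w1_link[]//] := eqVneq (w1 t) 0; rewrite addr0.
    by case/z_face/and3P=> tV ts n_eq; apply/and3P; rewrite subV'.
  by rewrite linearD /= dz boundary2 addr0.
exists (w0 + cone e w1); last by rewrite linearD /= dw0 /z' -addrA F2_addvv addr0.
apply: suppD (suppW (@faceW _ _) w0_face) _ => t.
rewrite ffunE; case: ifP => [te|_ /eqP//] /w1_link[].
by rewrite setD1K.
Qed.
End Acyclicity.

(** * The total differential squares to zero *)

Section Differentials.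
Variable k : nat.
Local Notation G := 'rV['F_2]_k.
Local Notation chain2 := (chain k (('F_2)^o)%type).
Local Notation elem2 := (@elem k (('F_2)^o)%type 1).
Implicit Types (a b e x : G) (s t V A : {set G}) (u v : chain2) (w : ambient k).

(** An instance for the right argument only: this is where boundaries are
expanded by [linear_sum]; the left argument is served by [tens_suml]. *)
Fact tens_linear u : linear (tens u).
Proof.
move=> l v v'; congr pair; rewrite /= ?scaler0 ?addr0 //.
by apply/ffunP=> st; rewrite !ffunE mulrDr scalerAr.
Qed.
HB.instance Definition _ u :=
  GRing.isLinear.Build 'F_2 chain2 (ambient k) *:%R (tens u) (tens_linear u).

Lemma tensDl u u' v : tens (u + u') v = tens u v + tens u' v.
Proof.
by congr pair; rewrite /= ?addr0 //; apply/ffunP=> st; rewrite !ffunE mulrDl.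
Qed.

Lemma tens_suml (I : Type) (r : seq I) (P : pred I) (F : I -> chain2) v :
  tens (\sum_(i <- r | P i) F i) v = \sum_(i <- r | P i) tens (F i) v.
Proof.
apply: (big_morph (fun u => tens u v)) => [u u'|]; first exact: tensDl.
by congr pair; apply/ffunP=> st; rewrite !ffunE mul0r.
Qed.

Lemma chain2E u : u = \sum_t u t *: elem2 t.
Proof.
rewrite {1}[u]chainE; apply: eq_bigr => t _; apply/ffunP=> t'; rewrite !ffunE.
by case: ifP => _; [rewrite [RHS]mulr1 | rewrite scaler0].
Qed.

Lemma d_v_d_v w : d_v (d_v w) = 0.
Proof.
congr pair; last by rewrite /= boundary2.
apply/ffunP=> -[s t]; rewrite ffunE /= [RHS]ffunE.
set z := [ffun t => w.1 (s, t)] : chain2.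
have -> : [ffun t => (d_v w).1 (s, t)] = boundary z.
  by apply/ffunP=> t'; rewrite ffunE /= ffunE.
by rewrite boundary2 ffunE.
Qed.

(** The two differentials act on different tensor factors; this is the
commutation on generators. *)
Lemma d_v_gen s t : d_v (d_h_gen s t) = \sum_(x in t) d_h_gen s (t :\ x).
Proof.
rewrite /d_h_gen; case: pickP => [a sa|_]; last by rewrite linear0 big1.
case: ifP => _; first exact: d_v_tens_col.
by rewrite d_v_tens boundary_elem linear_sum.
Qed.

Lemma d_hv w : d_h (d_v w) = d_v (d_h w).
Proof.
rewrite /d_h linear_sum; apply: eq_bigr => s _ /=.
pose f u : ambient k := \sum_t (u t : 'F_2) *: d_h_gen s t.
have f_lin : linear f.
  move=> l u u'; rewrite scaler_sumr -big_split; apply: eq_bigr => t _ /=.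
  by rewrite !ffunE scalerDl scalerA.
pose F := HB.pack_for {linear chain2 -> ambient k} f
  (GRing.isLinear.Build _ _ _ _ f f_lin).
pose z : chain2 := [ffun t => w.1 (s, t)].
transitivity (F (boundary z)).
  by apply: eq_bigr => t _ /=; rewrite ffunE.
rewrite /boundary !linear_sum; apply: eq_bigr => t _.
rewrite [RHS]linearZ /= d_v_gen scaler_sumr.
transitivity (\sum_(x in t) F (elem (z t) (t :\ x))); first exact: (linear_sum F).
apply: eq_bigr => x _.
rewrite /= /f (bigD1 (t :\ x)) //= !ffunE eqxx big1 ?addr0 // => t' /negPf ne_t.
by rewrite !ffunE ne_t scale0r.
Qed.

(** The simplex s stands for the affine simplex A = 0 |: s; this is the simplex
of A when the vertex b of A is taken as the origin. *)
Definition rebase A b := translate A b :\ 0.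

Lemma rebaseK A b : b \in A -> 0 |: rebase A b = translate A b.
Proof. by move=> Ab; rewrite setD1K // mem_translate add0r. Qed.

Lemma card_rebase A b : b \in A -> #|rebase A b|.+1 = #|A|.
Proof.
move=> Ab; have <- : #|translate A b| = #|A|.
  by rewrite card_imset //; apply/inv_inj/addGGK.
by rewrite [RHS](cardsD1 0) mem_translate add0r Ab.
Qed.

(** The differences of the points of an affine set do not depend on the
origin, so equivalent simplices have the same span and hence the same link. *)
Lemma set_span_rebase s b : 0 \notin s -> b \in 0 |: s -> set_span (rebase (0 |: s) b) = set_span s.
Proof.
move=> s0 sb; apply/eqP; rewrite eqEsubv; apply/andP; split; last first.
  have rb : b \in set_span (rebase (0 |: s) b).
    have [->|b_neq0] := eqVneq b 0; first exact: mem0v.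
    by rewrite mem_set_span // !inE b_neq0 mem_translate addGG setU11.
  apply: set_span_sub => x sx; have [->//|ne_xb] := eqVneq x b.
  rewrite -(addGGK b x) rpredD // mem_set_span // !inE addG_eq0 ne_xb.
  by rewrite mem_translate addGGK !inE sx orbT.
have mem_s y : y \in 0 |: s -> y \in set_span s.
  by rewrite in_setU1 => /predU1P[->|/mem_set_span//]; rewrite mem0v.
apply: set_span_sub => x; rewrite !inE mem_translate => /andP[_ /mem_s xb].
by rewrite -(addGGK b x) rpredD // mem_s.
Qed.

Lemma simplex_rebase s b : simplex s -> b \in 0 |: s -> simplex (rebase (0 |: s) b).
Proof.
move=> sS sb; have s0 := simplexN0 sS; rewrite simplexE set_span_rebase //.
move: sS; rewrite simplexE => /eqP ->.
by rewrite -eqSS card_rebase // cardsU1 s0.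
Qed.

Lemma card_face s x : simplex s -> x \in 0 |: s -> #|(0 |: s) :\ x| = #|s|.
Proof.
move=> /simplexN0 s0 sx; have := cardsD1 x (0 |: s).
by rewrite sx cardsU1 s0 !add1n => -[].
Qed.

(** A face of the affine simplex 0 |: s is again the affine simplex of an
independent set, after the origin is moved into it; this lets d_h be applied
again to the terms of d_h_sum. *)
Lemma face_rebase s x b : simplex s -> x \in 0 |: s -> b \in (0 |: s) :\ x ->
  let r := rebase ((0 |: s) :\ x) b in
  [/\ simplex r, #|r|.+1 = #|s|, link s \subset link r &
      c_aff ((0 |: s) :\ x) = c r].
Proof.
move=> sS sx /[dup] Ab /setD1P[_ sb] r; have s0 := simplexN0 sS.
have r_sub : r \subset rebase (0 |: s) b.
  apply/subsetP=> y; rewrite !inE !mem_translate.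
  by case/andP=> -> /setD1P[_ ->].
have rS := simplex_sub r_sub (simplex_rebase sS sb).
have bS := simplex_rebase sS sb.
split=> //.
- by rewrite card_rebase // card_face.
- rewrite -(link_eq (s := s) (s' := rebase (0 |: s) b)) ?linkS ?set_span_rebase //.
  by apply: succn_inj; rewrite card_rebase // cardsU1 s0.
by apply/esym/(@c_affE _ _ _ b); rewrite ?rebaseK ?simplexN0.
Qed.

(** On affine simplices d_h is the plain sum of the codimension one faces. *)
Lemma d_h_aff s x t : simplex s -> x \in 0 |: s -> (2 < #|s|)%N ->
  d_h (tens (c_aff ((0 |: s) :\ x)) (elem2 t)) =
    \sum_(y in (0 |: s) :\ x) tens (c_aff ((0 |: s) :\ x :\ y)) (elem2 t).
Proof.
move=> sS sx s_gt2; set A := _ :\ x.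
have [A0|[b Ab]] := set_0Vmem A.
  by move: s_gt2; rewrite -(card_face sS sx) -/A A0 cards0.
have [rS r_card _ ->] := face_rebase sS sx Ab; set r := rebase _ b in rS r_card *.
have r_gt1 : (1 < #|r|)%N by rewrite -ltnS r_card.
have [a ra] : exists a, a \in r by apply/card_gt0P; apply: ltnW.
rewrite (d_hS _ rS r_gt1 ra) d_h_sumE // tens_suml /d_h_sum rebaseK // -/A.
rewrite (reindex_inj (inv_inj (addGGK b))) /=.
apply: eq_big => [y|y _]; first by rewrite mem_translate addGGK.
rewrite -[c_aff (A :\ _)](c_aff_translate _ b).
suff -> : translate A b :\ (y + b) = translate (A :\ y) b by [].
apply/setP=> y'; rewrite !(inE, mem_translate).
by rewrite -[in LHS](inj_eq (inv_inj (addGGK b))) addGGK.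
Qed.

Lemma sum_pairs0 (U : lmodType 'F_2) A (F : {set G} -> U) :
  \sum_(x in A) \sum_(y in A :\ x) F (A :\ x :\ y) = 0.
Proof.
rewrite pair_big_dep /=.
rewrite (eq_bigl (fun xy : G * G => [&& xy.1 \in A, xy.2 \in A & xy.1 != xy.2])).
  apply: (@sum_sym0 _ _ (fun x y => [&& x \in A, y \in A & x != y])
    (fun x y => F (A :\ x :\ y))) => [x y|x|x y]; first by rewrite eq_sym andbCA.
    by rewrite eqxx !andbF.
  by congr F; apply/setP=> z; rewrite !inE andbCA.
by move=> [x y] /=; rewrite !inE [y == x]eq_sym [(x != y) && _]andbC.
Qed.

Lemma d_h_gen_big s t : simplex s -> (1 < #|s|)%N ->
  d_h_gen s t = tens (d_h_sum s) (elem2 t).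
Proof.
move=> sS s_gt1; rewrite /d_h_gen; case: pickP => [a sa|s0].
  by rewrite gtn_eqF // d_h_sumE.
by move: s_gt1; rewrite eq_card0.
Qed.

Lemma d_h_edge a b t : simplex [set a; b] -> a != b ->
  d_h (tens (c [set a; b]) (elem2 t)) =
    tens (c [set a] + c [set b] + c [set a + b]) (elem2 t).
Proof.
move=> sS ne_ab; have s_gt1 : (1 < #|[set a; b]|)%N by rewrite cards2 ne_ab.
rewrite (d_hS _ sS s_gt1 (set21 a b)); congr tens.
have Ea : [set a; b] :\ a = [set b] by rewrite setU1K // inE.
have Eb : [set a; b] :\ b = [set a] by rewrite setUC setU1K // inE eq_sym.
have -> : translate ([set a; b] :\ a) a = [set a + b].
  by rewrite Ea /translate imset_set1 addrC.
by rewrite big_setU1 ?inE //= big_set1 Ea Eb [LHS]addrC [X in X + _ = _]addrC.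
Qed.

(** For more than two vertices this is the cancellation of double faces of an
affine simplex. For an edge {a, b} the three faces go to a, b and a + b in G,
whose sum is 0. *)
Lemma d_h_d_h_gen s t : simplex s -> d_h (d_h_gen s t) = 0.
Proof.
move=> sS; case: (ltngtP #|s| 1) => [|s_gt1|s1]; last first.
- rewrite /d_h_gen; case: pickP => [a sa|_]; last by rewrite linear0.
  rewrite s1 /= /d_h big1 // => s' _; rewrite big1 // => t' _.
  by rewrite ffunE scale0r.
- rewrite d_h_gen_big // tens_suml linear_sum.
  have [s_gt2|s_le2] := ltnP 2 #|s|.
    rewrite -[RHS](sum_pairs0 (0 |: s) (fun A => tens (c_aff A) (elem2 t))).
    by apply: eq_bigr => x sx; apply: d_h_aff.
  have /cards2P[a [b [ne_ab E_s]]] : #|s| == 2 by rewrite eqn_leq s_le2.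
  rewrite {}E_s in sS *.
  have a0 := simplex_neq0 sS (set21 a b); have b0 := simplex_neq0 sS (set22 a b).
  have ab0 : a + b != 0 by rewrite addG_eq0.
  rewrite -linear_sum -tens_suml -/(d_h_sum _) -(d_h_sumE sS (set21 a b)).
  rewrite -d_hS ?set21 ?cards2 ?ne_ab // d_h_edge //.
  have -> : c [set a] + c [set b] + c [set a + b] =
      \sum_(x <- [:: a; b; a + b]) c [set x].
    by rewrite !big_cons big_nil addr0 addrA.
  rewrite tens_suml linear_sum !big_cons big_nil /= !d_h1 // addr0.
  congr pair; rewrite /= ?addr0 //; apply/ffunP=> t'; rewrite !ffunE.
  by case: eqP; rewrite ?addr0 // addrA F2_addvv.
rewrite ltnS leqn0 cards_eq0 => /eqP ->; rewrite /d_h_gen.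
by case: pickP => [a|_]; rewrite ?inE ?linear0.
Qed.

Lemma d_h_d_h w : d_h (d_h w) = 0.
Proof.
rewrite [X in d_h X]/d_h linear_sum big1 // => s /andP[sS _].
rewrite linear_sum big1 // => t _.
by rewrite linearZ /= d_h_d_h_gen // scaler0.
Qed.

Lemma d_totE w : d_tot k w = d_h w + d_v w.
Proof. by rewrite /d_tot add_lfunE !lfunE. Qed.

Lemma d_tot_sq0 : (d_tot k \o d_tot k = 0)%VF.
Proof.
apply/lfunP=> w; rewrite comp_lfunE [RHS]lfunE.
rewrite !d_totE !linearD /= d_h_d_h d_v_d_v d_hv.
by rewrite add0r addr0 F2_addvv.
Qed.

End Differentials.

(** * Columns and their vertical homology *)

Lemma span_ind (K : fieldType) (W : vectType K) (X : seq W) (P : W -> Prop) :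
    P 0 -> (forall l u v, P u -> P v -> P (l *: u + v)) ->
    (forall x, x \in X -> P x) ->
  forall w, w \in <<X>>%VS -> P w.
Proof.
move=> P0 P_lin PX w /(coord_span (X := in_tuple X)) ->; apply: (big_ind P) => // [u v Pu Pv|i _].
  by rewrite -[u]scale1r; apply: P_lin.
by rewrite -[_ *: _]addr0; apply: P_lin => //; apply/PX/mem_nth.
Qed.

Section Columns.
Variable k : nat.
Local Notation G := 'rV['F_2]_k.
Local Notation chain2 := (chain k (('F_2)^o)%type).
Local Notation elem2 := (@elem k (('F_2)^o)%type 1).
Implicit Types (a b e x : G) (s t V A : {set G}) (w : ambient k).

(** Both kinds of columns at once, so that facts on all E p q are checked on
elementary tensors. *)
Lemma E_ind (p q : int) (P : ambient k -> Prop) :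
    P 0 -> (forall l u v, P u -> P v -> P (l *: u + v)) ->
    (p != -1 -> forall s t, s \in simplices k p -> t \in link s ->
      t \in simplices k q -> P (tens (c s) (elem2 t))) ->
    (p = -1 -> q <= k%:Z - 2 -> forall a t, t \in simplices k q ->
      P (tens_col a t)) ->
  forall w, w \in E k p q -> P w.
Proof.
move=> P0 P_lin PE Pcol w; rewrite /E; case: eqP => [p_eq|p_neq].
  case: ifP => [q_le|_]; last by rewrite memv0 => /eqP ->.
  move: w; apply: (span_ind P0 P_lin) => _ /flatten_mapP[a _ /mapP[t tq ->]].
  by apply: Pcol => //; rewrite mem_enum in tq.
move: w; apply: (span_ind P0 P_lin) => _ /flatten_mapP[s sp /mapP[t tq ->]].
move: sp tq; rewrite !mem_enum in_setI => sp /andP[ts tq].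
by apply: PE => //; apply/eqP.
Qed.

Lemma mem_E_tens (p q : int) s t : p != -1 -> s \in simplices k p ->
  t \in link s -> t \in simplices k q -> tens (c s) (elem2 t) \in E k p q.
Proof.
move=> /negPf p_neq sp ts tq; rewrite /E p_neq; apply: memv_span.
apply/flatten_mapP; exists s; first by rewrite mem_enum.
by apply/mapP; exists t; rewrite ?mem_enum ?in_setI ?ts.
Qed.

Lemma mem_E_col (q : int) a t : q <= k%:Z - 2 -> t \in simplices k q ->
  tens_col a t \in E k (-1) q.
Proof.
move=> q_le tq; rewrite /E eqxx q_le; apply: memv_span.
apply/flatten_mapP; exists a; first by rewrite mem_enum.
by apply/mapP; exists t; rewrite ?mem_enum.
Qed.

Lemma simplicesP (n : int) s : reflect (simplex s /\ #|s|%:Z = n + 1) (s \in simplices k n).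
Proof. by rewrite inE; apply: (iffP andP) => -[sS /eqP]. Qed.

Lemma simplices_face (q : int) t x : t \in simplices k q -> x \in t ->
  t :\ x \in simplices k (q - 1).
Proof.
case/simplicesP=> tS t_card tx; apply/simplicesP; split.
  by apply: simplex_sub tS; apply: subD1set.
by move: t_card; rewrite (cardsD1 x t) tx add1n; move: #|t :\ x| => n; lia.
Qed.

Lemma d_v_E (p q : int) w : w \in E k p q -> d_v w \in E k p (q - 1).
Proof.
move: w; apply: E_ind => [|l u v Eu Ev|p_neq s t sp ts tq|-> q_le a t tq].
- by rewrite linear0 mem0v.
- by rewrite linearP rpredD // rpredZ.
- rewrite d_v_tens boundary_elem linear_sum rpred_sum // => x tx.
  by apply: mem_E_tens; rewrite ?link_face_sub ?simplices_face.
rewrite d_v_tens_col rpred_sum // => x tx.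
by apply: mem_E_col; rewrite ?simplices_face //; lia.
Qed.

(** At p = 0 the bound q <= k - 2 of the column -1 holds automatically, since a
simplex in the link of a vertex has at most k - 1 vertices. *)
Lemma d_h_E (p q : int) w : w \in E k p q -> d_h w \in E k (p - 1) q.
Proof.
move: w; apply: E_ind => [|l u v Eu Ev|p_neq s t sp ts tq|-> q_le a t tq].
- by rewrite linear0 mem0v.
- by rewrite d_h_linear; apply: rpredD Ev; apply: rpredZ.
- have [sS s_card] := simplicesP _ _ sp.
  have [_ t_card] := simplicesP _ _ tq.
  have st_card := card_link ts.
  have [p_eq|p_neq0] := eqVneq p 0.
    have /cards1P[a s_a] : #|s| == 1 by lia.
    rewrite s_a d_h1 ?p_eq; last by apply: (simplex_neq0 sS); rewrite s_a set11.
    by apply: mem_E_col => //; lia.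
  have s_gt1 : (1 < #|s|)%N by lia.
  have [a sa] : exists a, a \in s by apply/card_gt0P; apply: ltnW.
  rewrite (d_hS _ sS s_gt1 sa) d_h_sumE // tens_suml rpred_sum // => x sx.
  have [A0|[b Ab]] := set_0Vmem ((0 |: s) :\ x).
    by move: s_gt1; rewrite -(card_face sS sx) A0 cards0.
  have [rS r_card /subsetP s_r ->] := face_rebase sS sx Ab.
  apply: mem_E_tens; rewrite ?s_r //; first by lia.
  by apply/simplicesP; split=> //; lia.
rewrite /d_h big1 ?mem0v // => s _; rewrite big1 // => t' _.
by rewrite ffunE scale0r.
Qed.

(** A simplex and a member of its link have at most k vertices together. *)
Lemma E_top (p q : int) : k%:Z - 1 <= p + q -> E k p q = 0%VS.
Proof.
move=> pq; apply/eqP; rewrite -subv0; apply/subvP; apply: E_ind => //.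
- exact: mem0v.
- by move=> l u v Eu Ev; rewrite rpredD // rpredZ.
- move=> _ s t /simplicesP[_ s_card] /card_link st /simplicesP[_ t_card]; lia.
by move=> p_eq q_le; rewrite p_eq in pq; lia.
Qed.

Definition slice w s : chain2 := [ffun t => w.1 (s, t)].

Lemma class_rebase s s' : simplex s -> s' \in sim_class s ->
  exists2 z, z \in 0 |: s & s' = rebase (0 |: s) z.
Proof.
move=> sS /[dup] /simplex_class s'S; rewrite inE => /andP[_].
have [s0 s'0] := (simplexN0 sS, simplexN0 s'S).
case/(simP s0 s'0)=> z E_s'; exists z; last by rewrite /rebase -E_s' setU1K.
by move/setP/(_ 0): E_s'; rewrite setU11 mem_translate add0r.
Qed.

Lemma link_class s s' : simplex s -> s' \in sim_class s -> link s' = link s.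
Proof.
move=> sS ss'; apply: link_eq; last exact: card_sim.
by have [z sz ->] := class_rebase sS ss'; rewrite set_span_rebase // simplexN0.
Qed.

Lemma c_class s s' : simplex s -> s' \in sim_class s -> c s' = c s.
Proof. by move=> sS ss'; rewrite /c (sim_class_eq sS ss'). Qed.

(** An element of a column is determined by its slices at the chosen class
representatives; with the converse [E_tens], the column is a direct sum of the
chain complexes of the links of these representatives. *)
Lemma E_slices (p q : int) w : p != -1 -> w \in E k p q ->
  [/\ w.2 = 0,
      w = \sum_(s in simplices k p | class_repr s == s) tens (c s) (slice w s),
      forall s, supp [pred t : {set G} | (t \in link s) && (t \in simplices k q)] (slice w s)
    & forall s t, w.1 (s, t) != 0 -> s \in simplices k p].
Proof.
move=> p_neq Ew; move: w Ew; apply: E_ind => [|l u v|_ s t sp ts tq|p_eq]; last 1 first.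
- by rewrite p_eq in p_neq.
- split=> // [|s t|s t]; rewrite ?ffunE ?eqxx //.
  apply/esym/big1=> s _; rewrite [slice _ _](_ : _ = 0) ?linear0 //.
  by apply/ffunP=> t; rewrite !ffunE.
- case=> u2 uE u_supp u_p [v2 vE v_supp v_p]; split.
  + by rewrite /= u2 v2 scaler0 addr0.
  + rewrite [in LHS]uE [in LHS]vE scaler_sumr -big_split; apply: eq_bigr => s _ /=.
    by rewrite -linearP; congr tens; apply/ffunP=> t; rewrite !ffunE.
  + move=> s t; rewrite !ffunE; have := u_supp s t; have := v_supp s t.
    rewrite !ffunE; have [->|_ _ -> //] := eqVneq (u.1 (s, t)) 0.
    by rewrite scaler0 add0r => v_st _ /v_st.
  move=> s t; rewrite /= !ffunE; have := u_p s t; have := v_p s t.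
  have [->|_ _ -> //] := eqVneq (u.1 (s, t)) 0.
  by rewrite scaler0 add0r => v_st _ /v_st.
have [sS s_card] := simplicesP _ _ sp; have rS := class_reprP sS.
have nz s' t' : (tens (c s) (elem2 t)).1 (s', t') != 0 ->
    s' \in sim_class s /\ t' = t.
  rewrite /= ffunE /= cE [elem _ _ _]ffunE; case: (s' \in _) => /=; last by [].
  by case: (t' =P t) => // _; rewrite mulr0 eqxx.
split=> // [|s' t'|s' t' /nz[ss' _]]; last first.
- by apply/simplicesP; rewrite (card_sim sS ss') (simplex_class ss').
- by rewrite ffunE => /nz[ss' ->]; rewrite inE /= (link_class sS ss') ts.
rewrite (bigD1 (class_repr s)) /=; last first.
  rewrite (class_repr_eq sS rS) eqxx andbT; apply/simplicesP.
  by rewrite (card_sim sS rS) (simplex_class rS).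
rewrite (c_class sS rS) big1 ?addr0 => [|s' /andP[/andP[_ /eqP s'_r] ne_s']].
  congr tens; apply/ffunP=> t'; rewrite [RHS]ffunE /= [RHS]ffunE /= cE rS.
  by rewrite mul1r.
rewrite [slice _ _](_ : _ = 0) ?linear0 //; apply/ffunP=> t'.
rewrite [LHS]ffunE [RHS]ffunE; apply/eqP/contraT=> /nz[ss' _].
by rewrite -s'_r (class_repr_eq sS ss') eqxx in ne_s'.
Qed.

Lemma E_tens (p q : int) s u : p != -1 -> s \in simplices k p ->
    supp [pred t : {set G} | (t \in link s) && (t \in simplices k q)] u ->
  tens (c s) u \in E k p q.
Proof.
move=> p_neq sp u_supp; rewrite [u]chain2E linear_sum rpred_sum // => t _.
rewrite linearZ /=; have [->|/u_supp/andP[ts tq]] := eqVneq (u t) 0.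
  by rewrite scale0r mem0v.
by rewrite rpredZ // mem_E_tens.
Qed.

(** [link_acyclic] slice by slice; total degree k - 2 is the first one where a
link reaches its top dimension. *)
Lemma column_exact (p q : int) w : p != -1 -> p + q <= k%:Z - 3 -> w \in E k p q ->
  d_v w = 0 -> exists2 v, v \in E k p (q + 1) & d_v v = w.
Proof.
move=> p_neq pq Ew dw; have [w2 wE w_supp w_p] := E_slices p_neq Ew.
have slice_bd s : exists u, s \in simplices k p ->
    supp [pred t : {set G} | (t \in link s) && (t \in simplices k (q + 1))] u /\
    boundary u = slice w s.
  have [sp|] := boolP (s \in simplices k p); last by exists 0.
  have [sS s_card] := simplicesP _ _ sp.
  have [q_lt|q_ge] := ltP q (-1).
    exists 0 => _; split=> [t|]; first by rewrite ffunE eqxx.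
    rewrite linear0; apply/ffunP=> t; rewrite [LHS]ffunE; apply/esym/eqP/contraT.
    by case/w_supp/andP=> _ /simplicesP[_]; lia.
  have [||| u u_face du] := @link_acyclic k (('F_2)^o)%type setT s `|(p + q + 2)%R|%N (slice w s).
  - by rewrite setUT dim_set_spanT; lia.
  - move=> t /w_supp/andP[ts /simplicesP[tS t_card]]; apply/and3P; split=> //.
    by apply/eqP; lia.
  - have /(congr1 (fun w => slice w s)) := dw; rewrite (_ : slice 0 s = 0) => [<-|].
      by apply/ffunP=> t; rewrite [RHS]ffunE /= [RHS]ffunE.
    by apply/ffunP=> t; rewrite !ffunE.
  exists u => _; split=> // t /u_face/and3P[_ ts /eqP n_eq].
  rewrite inE /= ts; apply/simplicesP; split; last by lia.
  move: ts; rewrite inE => /andP[_]; apply: simplex_sub; exact: subsetUr.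
have {slice_bd} [f fP] := fin_all_exists slice_bd.
exists (\sum_(s in simplices k p | class_repr s == s) tens (c s) (f s)).
  rewrite rpred_sum // => s /andP[sp _]; apply: E_tens => //.
  by have [] := fP s sp.
rewrite linear_sum [RHS]wE; apply: eq_bigr => s /andP[sp _] /=.
by rewrite d_v_tens; have [_ ->] := fP s sp.
Qed.

Lemma E_colP (q : int) w : w \in E k (-1) q ->
  w.1 = 0 /\ supp (mem (simplices k q)) w.2.
Proof.
move: w; apply: E_ind => [|l u v [u1 u2] [v1 v2]|//|_ _ a t tq].
- by split=> // t; rewrite ffunE eqxx.
- split; first by rewrite /= u1 v1 scaler0 addr0.
  move=> t; rewrite !ffunE; have := u2 t; have := v2 t.
  have [->|_ _ -> //] := eqVneq (u.2 t) 0.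
  by rewrite scaler0 add0r => v_t _ /v_t.
split=> // t'; rewrite ffunE; case: (t' =P t) => [->//|_].
by rewrite eqxx.
Qed.

Definition col_of (z : chain k G) : ambient k := (0, z).

Fact col_of_linear : linear col_of.
Proof. by move=> l u v; congr pair; rewrite /= scaler0 addr0. Qed.
HB.instance Definition _ := GRing.isLinear.Build 'F_2 (chain k G) (ambient k) *:%R
  col_of col_of_linear.

Lemma mem_E_col_of (q : int) z : q <= k%:Z - 2 ->
  supp (mem (simplices k q)) z -> col_of z \in E k (-1) q.
Proof.
move=> q_le z_supp; rewrite [z]chainE linear_sum rpred_sum // => t _.
have [->|/z_supp tq] := eqVneq (z t) 0; last exact: mem_E_col.
rewrite [elem _ _](_ : _ = 0) ?linear0 ?mem0v //.
by apply/ffunP=> t'; rewrite !ffunE; case: ifP.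
Qed.

(** The column -1 is cut off above q = k - 2, so at q = k - 2 the chain z lives
in X but not in the column. *)
Lemma col_cycle (q : int) w : q <= k%:Z - 2 -> w \in E k (-1) q -> d_v w = 0 ->
  exists2 z, supp (mem (simplices k (q + 1))) z & w = col_of (boundary z).
Proof.
move=> q_le Ew dw; have [w1 w_supp] := E_colP Ew.
have wE : w = col_of w.2 by rewrite /col_of -w1; case: (w).
have [q_lt|q_ge] := ltP q (-1).
  exists 0 => [t|]; first by rewrite ffunE eqxx.
  rewrite linear0 wE; congr col_of; apply/ffunP=> t; rewrite [RHS]ffunE.
  by apply/eqP/contraT=> /w_supp/simplicesP[_]; lia.
have [||| u u_face du] := @link_acyclic k _ setT set0 `|(q + 1)%R|%N w.2.
- by rewrite setUT dim_set_spanT; lia.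
- move=> t /w_supp/simplicesP[tS t_card]; apply/and3P; split=> //.
    by rewrite inE set0U -setI_eq0 set0I eqxx.
  by rewrite cards0; apply/eqP; lia.
- by have /(congr1 snd) := dw.
exists u; last by rewrite du.
move=> t /u_face/and3P[_]; rewrite inE set0U cards0 => /andP[_ tS] /eqP n_eq.
by apply/simplicesP; split=> //; lia.
Qed.

End Columns.

(** * The column filtration *)

Section Filtration.
Variable k : nat.
Local Notation G := 'rV['F_2]_k.
Local Notation F := (filt k).
Local Notation d := (d_tot k).
Implicit Types (m n : int) (a b e x : G) (s t V A : {set G}) (w : ambient k).

Lemma E_out (p q : int) : (p < -1) || (k%:Z <= p) -> E k p q = 0%VS.
Proof.
move=> p_out; apply/eqP; rewrite -subv0; apply/subvP; apply: E_ind.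
- exact: mem0v.
- by move=> l u v Eu Ev; rewrite rpredD // rpredZ.
- move=> _ s t /simplicesP[sS s_card]; have := dim_set_span_leq s.
  by move: sS; rewrite simplexE => /eqP -> s_le; move: p_out; lia.
by move=> p_eq; move: p_out; rewrite p_eq; lia.
Qed.

(** Valid for every integer m, since E m q vanishes outside the range of the
columns; so the filtration is handled by induction on m. *)
Lemma filtS m n : F m n = (F (m - 1) n + E k m (n - m))%VS.
Proof.
have [m_out|m_in] := boolP ((m < -1) || (k%:Z <= m)).
  rewrite E_out // addv0; apply: eq_bigl => i; rewrite /column.
  by have := ltn_ord i; move: m_out; set j := nat_of_ord i; lia.
have m_lt : (`|(m + 1)%R| < k.+1)%N by move: m_in; lia.
pose i0 := Ordinal m_lt; have i0E : column i0 = m by rewrite /column /=; move: m_in; lia.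
rewrite /filt (bigD1 i0) /=; last by rewrite i0E.
rewrite addvC /tot_col i0E; congr (_ + _)%VS; apply: eq_bigl => i.
rewrite -val_eqE /= /column; set j := nat_of_ord i; move: m_in; lia.
Qed.

Lemma filt_low m n : m < -1 -> F m n = 0%VS.
Proof. by move=> m_lt; apply: big_pred0 => i; rewrite /column; lia. Qed.

Lemma filt_mono m m' n : m <= m' -> (F m n <= F m' n)%VS.
Proof.
move=> le_m; apply/subv_sumP => i le_i; apply: (sumv_sup i) => //.
exact: le_trans le_i le_m.
Qed.

Lemma E_filt (p q : int) m n : p <= m -> n = p + q -> (E k p q <= F m n)%VS.
Proof.
move=> le_p ->; apply: subv_trans (filt_mono _ le_p).
by rewrite [F p _]filtS (_ : p + q - p = q) ?addvSr; lia.
Qed.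

Lemma mem_E_filt (p q : int) m n w : p <= m -> n = p + q ->
  w \in E k p q -> w \in F m n.
Proof. by move=> le_p n_eq; apply/subvP/E_filt. Qed.

Lemma filt_tot m n : (F m n <= tot k n)%VS.
Proof. by apply/subv_sumP=> i _; apply: (sumv_sup i). Qed.

Lemma tot_top n : k%:Z - 1 <= n -> tot k n = 0%VS.
Proof.
move=> n_ge; rewrite /tot big1 // => i _; apply: E_top; rewrite /column; lia.
Qed.

Lemma filt_d m n : (d @: F m n <= F m (n - 1))%VS.
Proof.
rewrite limg_sum; apply/subv_sumP=> i le_i; apply/subvP=> _ /memv_imgP[w Ew ->].
rewrite d_totE; apply: rpredD.
  by have := d_h_E Ew; apply: subvP; apply: E_filt; lia.
by have := d_v_E Ew; apply: subvP; apply: E_filt; lia.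
Qed.

Lemma filt_slices m n w s t : w \in F m n -> w.1 (s, t) != 0 -> #|s|%:Z <= m + 1.
Proof.
case/memv_sumP=> f Ef -> nz; have [s_le|s_gt] := lerP (#|s|%:Z) (m + 1) => //.
case/eqP: nz; apply: (big_ind (fun w : ambient k => w.1 (s, t) = 0)) => [|u v /= us vs|i le_i].
- by rewrite ffunE.
- by rewrite ffunE us vs addr0.
have Ei := Ef i le_i; have [i_eq|i_neq] := eqVneq (column i) (-1).
  by move: Ei; rewrite /tot_col i_eq => /E_colP[-> _]; rewrite ffunE.
have [_ _ _ slices] := E_slices i_neq Ei.
by apply/eqP/contraT=> /slices/simplicesP[_ s_card]; move: s_gt le_i; rewrite s_card; lia.
Qed.

Lemma d_tot_d_tot w : d (d w) = 0.
Proof. by rewrite -comp_lfunE d_tot_sq0 lfunE. Qed.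

(** The columns p >= 0 are removed from the top: the leading component of a
cycle is a vertical cycle, hence a vertical boundary by [column_exact], and
subtracting a total boundary lowers the filtration. *)
Lemma filt_exact m n w : n <= k%:Z - 3 -> w \in F m n -> d w = 0 ->
  exists2 v, v \in F m (n + 1) & w - d v \in F (-1) n.
Proof.
move=> n_le; have [m_lt|m_ge] := ltP m (-1).
  move=> Fw _; exists 0; first exact: mem0v.
  by rewrite linear0 subr0; apply: subvP Fw; apply: filt_mono; lia.
have -> : m = (`|(m + 1)%R|%N)%:Z - 1 by lia.
elim: `|_|%N w => [|j IH] w.
  by move=> Fw _; exists 0; rewrite ?mem0v // linear0 subr0.
set m' := _ - 1; have jE : j%:Z - 1 = m' - 1 by rewrite /m'; lia.
have m'_ge : 0 <= m' by rewrite /m'; lia.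
move=> /[dup] Fw; rewrite filtS => /memv_addP[w' Fw' [w0 Ew0 wE]] dw.
have dw0 : d_v w0 = 0.
  have m'_neq : m' != -1 by apply/eqP; lia.
  have Edw := d_v_E Ew0.
  have Fdw : d_v w0 \in F (m' - 1) (n - 1).
    have -> : d_v w0 = - (d w' + d_h w0).
      by apply/eqP; rewrite -addr_eq0 addrC -addrA -d_totE; move: dw; rewrite wE linearD => ->.
    rewrite rpredN rpredD //.
      by apply: subvP (filt_d _ _) _ _; apply: memv_img.
    by have := d_h_E Ew0; apply: subvP; apply: E_filt; lia.
  have [w02 _ _ slices] := E_slices m'_neq Edw.
  rewrite [LHS]surjective_pairing w02; congr pair; apply/ffunP=> -[s t].
  rewrite [RHS]ffunE; apply/eqP/contraT=> /[dup] /(filt_slices Fdw) s_le.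
  by move/slices/simplicesP=> [_ s_card]; move: s_le; rewrite s_card; lia.
have [||v0 Ev0 dv0] := column_exact _ _ Ew0 dw0; [by apply/eqP; lia|by lia|].
have Fv0 : v0 \in F m' (n + 1).
  by apply: subvP Ev0; apply: E_filt; lia.
have [||v Fv Fwv] := IH (w - d v0).
- rewrite jE wE d_totE dv0 opprD addrACA subrr addr0 rpredB //.
  by have := d_h_E Ev0; apply: subvP; apply: E_filt; lia.
- by rewrite linearB /= d_tot_d_tot dw subr0.
exists (v0 + v); last by rewrite linearD /= opprD addrA.
by apply: rpredD => //; apply: subvP Fv; rewrite jE; apply: filt_mono; lia.
Qed.

End Filtration.

(** * The column -1 is killed by d^2 *)

Section Surjectivity.
Variable k : nat.
Local Notation G := 'rV['F_2]_k.
Local Notation chain2 := (chain k (('F_2)^o)%type).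
Local Notation elem2 := (@elem k (('F_2)^o)%type 1).
Local Notation F := (filt k).
Local Notation d := (d_tot k).
Implicit Types (m n : int) (a b e x : G) (s t V A : {set G}) (w : ambient k).

Lemma d_h_col (z : chain k G) : d_h (col_of z) = 0.
Proof.
rewrite /d_h big1 // => s _; rewrite big1 // => t _.
by rewrite ffunE scale0r.
Qed.

Lemma d_v_col (z : chain k G) : d_v (col_of z) = col_of (boundary z).
Proof.
have -> : d_v (col_of z) = \sum_t d_v (col_of (elem (z t) t)).
  by rewrite -!linear_sum -chainE.
have -> : col_of (boundary z) = \sum_t col_of (boundary (elem (z t) t)).
  by rewrite -!linear_sum -chainE.
apply: eq_bigr => t _.
by rewrite [LHS]d_v_tens_col boundary_elem linear_sum.
Qed.

Lemma d_tot_col (q : int) w : w \in E k (-1) q -> d w = d_v w.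
Proof.
case/E_colP=> w1 _; rewrite d_totE (_ : w = col_of w.2) ?d_h_col ?add0r //.
by rewrite /col_of -w1; case: (w).
Qed.

Lemma tens_colD a b t : tens_col (a + b) t = tens_col a t + tens_col b t.
Proof.
congr pair; rewrite /= ?addr0 //; apply/ffunP=> t'; rewrite !ffunE.
by case: ifP; rewrite ?addr0.
Qed.

(** A spanning set with at most k elements is a basis; so membership in a link,
and the sizes involved, follow from spanning the basis S. *)
Lemma basis_link (S s t : {set G}) : simplex S -> #|S| = k ->
    (#|s| + #|t| <= k)%N -> {in S, forall x, x \in set_span (s :|: t)} ->
  t \in link s /\ (#|s| + #|t| = k)%N.
Proof.
rewrite simplexE => /eqP SS S_card st_card /set_span_sub/dimvS; rewrite SS S_card => k_le.
have st_dim := leq_trans (dim_set_span (s :|: t)) (leq_card_setU s t).1.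
rewrite linkE; split; first by rewrite eqn_leq st_dim (leq_trans st_card).
by apply/eqP; rewrite eqn_leq st_card (leq_trans k_le).
Qed.

Lemma posz_pred1 (i : nat) : i.+1 = k -> i%:Z = k%:Z - 2 + 1.
Proof. by lia. Qed.

Lemma posz_pred2 (i : nat) : i.+2 = k -> i%:Z = k%:Z - 3 + 1.
Proof. by lia. Qed.

Lemma degree_col1 : k%:Z - 2 = 1 + (k%:Z - 3).
Proof. by lia. Qed.

(** With T = S \ a and p the sum of T, the preimage is
c{a, p} (x) dT + c{a} (x) T + (c{p} + c{a + p}) (x) u, where u = dS - T is the
cone with apex a over dT. All tensors are legitimate because p is not in the
span of a proper subset of T: any x in T is recovered from p and T \ x. The
boundary of the last three terms cancels d_h of the first one, up to
a (x) T + (p + (a + p)) (x) u = a (x) dS. *)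
Lemma basis_boundary_hit (S : {set G}) a : (2 <= k)%N -> simplex S -> #|S| = k -> a \in S ->
  exists2 v, v \in F 1 (k%:Z - 2) & d v = col_of (boundary (elem a S)).
Proof.
move=> k_ge2 SS S_card Sa; set T := S :\ a.
have T_card : #|T|.+1 = k by move: (cardsD1 a S); rewrite Sa S_card add1n.
have TS x : x \in T -> x \in S by case/setD1P.
pose p := \sum_(x in T) x.
have p_x x : x \in T -> p - x \in set_span (T :\ x).
  move=> Tx; rewrite /p (big_setD1 x) //= addrAC subrr add0r rpred_sum // => y.
  exact: mem_set_span.
have Tx_card x : x \in T -> (#|T :\ x|.+2 = k)%N.
  by move=> Tx; move: T_card; rewrite (cardsD1 x T) Tx add1n.
have Sx_card x : x \in T -> (#|S :\ x|.+1 = k)%N.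
  by move=> /TS Sx; move: (cardsD1 x S); rewrite Sx S_card add1n.
(* exchange: x may be replaced by b in a spanning set if b - x is spanned by the
   other elements *)
have mem_x x y b t : x \in T -> b - x \in set_span t -> b \in t ->
    {in S :\ x, forall y, y \in set_span t} -> y \in S -> y \in set_span t.
  move=> Tx bx tb St Sy; have [->|ne_yx] := eqVneq y x; last by apply: St; rewrite !inE ne_yx.
  have -> : x = b - (b - x) by rewrite opprB addrC subrK.
  by rewrite rpredB // mem_set_span.
have link1 x b : x \in T -> b - x \in set_span (S :\ x) -> S :\ x \in link [set b].
  move=> Tx bx; apply: (basis_link SS S_card _ _).1 => [|y].
    by rewrite cards1 add1n Sx_card.
  apply: mem_x Tx _ (setU11 _ _) _; first by apply: subvP bx; rewrite set_spanS ?subsetUr.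
  by move=> z Sz; rewrite mem_set_span // inE Sz orbT.
have sub_x x : (set_span (T :\ x) <= set_span (S :\ x))%VS.
  by rewrite set_spanS // setSD // subD1set.
have Sx_a x : x \in T -> a \in set_span (S :\ x).
  by case/setD1P=> ne_xa _; rewrite mem_set_span // !inE eq_sym ne_xa.
have link_p x : x \in T -> S :\ x \in link [set p].
  by move=> Tx; rewrite link1 // (subvP (sub_x x)) ?p_x.
have link_ap x : x \in T -> S :\ x \in link [set a + p].
  move=> Tx; rewrite link1 // -addrA rpredD ?Sx_a //.
  by rewrite (subvP (sub_x x)) ?p_x.
have link_a : T \in link [set a].
  apply: (basis_link SS S_card _ _).1 => [|y Sy]; first by rewrite cards1 add1n T_card.
  by rewrite mem_set_span // setD1K.
have link2 x : x \in T -> T :\ x \in link [set a; p] /\ (#|[set a; p]| = 2)%N.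
  move=> Tx; have [| y|ap_link ap_card] := @basis_link S [set a; p] (T :\ x) SS S_card.
  - move: (Tx_card x Tx); rewrite cards2; set i := #|_|; by case: (_ != _); lia.
  - apply: (@mem_x x _ p) => //.
    + by apply: subvP (p_x x Tx); rewrite set_spanS ?subsetUr.
    + by rewrite !inE eqxx orbT.
    move=> z /setD1P[ne_zx Sz]; rewrite mem_set_span // !inE ne_zx Sz andbT /=.
    by case: (z == a); rewrite ?orbT.
  split=> //; move: ap_card (Tx_card x Tx).
  by set i := #|_|; set j := #|_|; lia.
have [x0 Tx0] : exists x, x \in T by apply/card_gt0P; move: T_card; set i := #|_|; lia.
have [ap_link ap_card] := link2 x0 Tx0.
have apS := (link_simplex ap_link).1.
have ne_ap : a != p by move: ap_card; rewrite cards2; case: (a != p).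
have sim1 b t : t \in link [set b] -> [set b] \in simplices k 0 /\ b != 0.
  case/link_simplex=> bS _; split; last by apply: (simplex_neq0 bS); rewrite set11.
  by apply/simplicesP; rewrite cards1.
have mem_E0 b t : (#|t|.+1 = k)%N -> t \in link [set b] ->
    tens (c [set b]) (elem2 t) \in F 1 (k%:Z - 2).
  move=> t_card bt; apply: (mem_E_filt (p := 0) (q := k%:Z - 2)); rewrite ?add0r //.
  have [sb _] := sim1 b t bt; apply: mem_E_tens => //.
  by apply/simplicesP; rewrite (link_simplex bt).2; split=> //; apply: posz_pred1.
pose u : chain2 := \sum_(x in T) elem2 (S :\ x).
have bd_S : boundary (elem2 S) = elem2 T + u by rewrite boundary_elem (big_setD1 a).
have bd_u : boundary u = boundary (elem2 T).
  have := congr1 (@boundary _ _) bd_S; rewrite boundary2 linearD /= => /esym/eqP.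
  by rewrite addr_eq0 F2_oppv => /eqP ->.
exists (tens (c [set a; p]) (boundary (elem2 T)) + (tens (c [set a]) (elem2 T)
    + (tens (c [set p]) u + tens (c [set a + p]) u))).
  rewrite rpredD //.
    apply: (mem_E_filt (p := 1) (q := k%:Z - 3)); rewrite // -?degree_col1 //.
    rewrite boundary_elem linear_sum rpred_sum // => x Tx; apply: mem_E_tens => //.
    - by apply/simplicesP; rewrite ap_card.
    - by have [] := link2 x Tx.
    apply/simplicesP; split; first by have [/link_simplex[]] := link2 x Tx.
    exact: posz_pred2 (Tx_card x Tx).
  rewrite rpredD ?mem_E0 //; rewrite !linear_sum rpredD ?rpred_sum // => x Tx.
    by rewrite mem_E0 ?Sx_card ?link_p.
  by rewrite mem_E0 ?Sx_card ?link_ap.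
have d_h_u b : (forall x, x \in T -> S :\ x \in link [set b]) ->
    d_h (tens (c [set b]) u) = \sum_(x in T) tens_col b (S :\ x).
  move=> bT; rewrite !linear_sum; apply: eq_bigr => x Tx /=.
  by rewrite d_h1 //; have [] := sim1 _ _ (bT x Tx).
rewrite d_totE !linearD /= !d_v_tens boundary2 linear0 add0r bd_u.
rewrite (d_h_u p link_p) (d_h_u (a + p) link_ap) d_h1; last by have [] := sim1 _ _ link_a.
rewrite -big_split /=.
under [X in _ + (_ + X) + _]eq_bigr => x _ do
  rewrite -tens_colD addrCA F2_addvv addr0.
have -> : d_h (tens (c [set a; p]) (boundary (elem2 T))) =
    tens (c [set a] + c [set p] + c [set a + p]) (boundary (elem2 T)).
  rewrite boundary_elem !linear_sum; apply: eq_bigr => x Tx /=.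
  exact: d_h_edge.
have <- : tens_col a T + \sum_(x in T) tens_col a (S :\ x) =
    col_of (boundary (elem a S)).
  by rewrite boundary_elem linear_sum [RHS](big_setD1 a).
(* in characteristic 2 what d_h of the edge term yields cancels against d_v of
   the vertex terms *)
have cancel3 (x y z w : ambient k) : x + y + z + w + (x + (y + z)) = w.
  by rewrite -[x + y + z]addrA addrAC F2_addvv add0r.
by rewrite !tensDl; apply: cancel3.
Qed.

(** The cycles of the column -1 in top degree are boundaries of chains on the
bases S of G, and the coefficient at S, being in G, is a combination of the
elements of S. *)
Lemma col_cycle_bounds w : (2 <= k)%N -> w \in F (-1) (k%:Z - 3) -> d w = 0 ->
  exists2 v, v \in F 1 (k%:Z - 2) & d v = w.
Proof.
move=> k_ge2; rewrite filtS filt_low // add0v => Ew dw.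
have Ew' : w \in E k (-1) (k%:Z - 2) by move: Ew; congr (_ \in E _ _ _); lia.
have dvw : d_v w = 0 by rewrite -(d_tot_col Ew').
have [|z z_supp ->] := col_cycle _ Ew' dvw; first by lia.
suff /memv_imgP[v Fv ->] : col_of (boundary z) \in (d @: F 1 (k%:Z - 2))%VS by exists v.
have -> : col_of (boundary z) = \sum_S col_of (boundary (elem (z S) S)).
  by rewrite -!linear_sum -chainE.
apply: rpred_sum => S _.
have [->|/z_supp/simplicesP[SS S_card]] := eqVneq (z S) 0.
  by rewrite (_ : elem _ _ = 0) ?linear0 ?mem0v //; apply/ffunP=> t; rewrite !ffunE if_same.
have S_k : #|S| = k by lia.
have Sz : z S \in set_span S.
  suff -> : set_span S = fullv by apply: memvf.
  apply/eqP; rewrite eqEdim subvf dimvf dim_matrix mul1r /=.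
  by move: SS; rewrite simplexE S_k => /eqP ->.
move: (z S) Sz; apply: span_ind => [|l g g' Sg Sg'|a].
- by rewrite (_ : elem _ _ = 0) ?linear0 ?mem0v //; apply/ffunP=> t; rewrite !ffunE if_same.
- by rewrite elem_linear !linearP rpredD // rpredZ.
rewrite mem_enum => Sa; have [v Fv <-] := basis_boundary_hit k_ge2 SS S_k Sa.
exact: memv_img.
Qed.

(** The shift 2 is only used in degree k - 3, to go from the column -1 to the
column 1; elsewhere a cycle bounds inside its own filtration step. *)
Lemma cycle_bounds m n w : (2 <= k)%N -> n != k%:Z - 2 -> w \in F m n -> d w = 0 ->
  exists2 v, v \in F (m + 2) (n + 1) & d v = w.
Proof.
move=> k_ge2 n_neq Fw dw; have [n_ge|n_lt] := lerP (k%:Z - 1) n.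
  exists 0; first exact: mem0v.
  by move: (subvP (filt_tot _ _ _) _ Fw); rewrite tot_top // memv0 linear0 => /eqP ->.
have [m_lt|m_ge] := ltP m (-1).
  by move: Fw; rewrite filt_low // memv0 => /eqP ->; exists 0; rewrite ?linear0 ?mem0v.
have n_le : n <= k%:Z - 3 by move/eqP: n_neq; lia.
have [v Fv Fw1] := filt_exact n_le Fw dw; set w1 := w - d v in Fw1.
have dw1 : d w1 = 0 by rewrite linearB /= d_tot_d_tot dw subr0.
suff [v1 Fv1 dv1] : exists2 v1, v1 \in F 1 (n + 1) & d v1 = w1.
  exists (v + v1); last by rewrite linearD /= dv1 addrC subrK.
  apply: rpredD; first by apply: subvP Fv; apply: filt_mono; lia.
  by apply: subvP Fv1; apply: filt_mono; lia.
have [n_eq|n_neq3] := eqVneq n (k%:Z - 3).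
  rewrite n_eq in Fw1 *; have [v1 Fv1 dv1] := col_cycle_bounds k_ge2 Fw1 dw1.
  by exists v1 => //; move: Fv1; congr (_ \in F _ _); lia.
move: Fw1; rewrite filtS filt_low // add0v => Ew1.
have dvw1 : d_v w1 = 0 by rewrite -(d_tot_col Ew1).
have [|z z_supp ->] := col_cycle _ Ew1 dvw1; first by lia.
exists (col_of z); last by rewrite d_totE d_h_col add0r d_v_col.
apply: (mem_E_filt (p := -1) (q := n + 2)); [lia|lia|].
apply: mem_E_col_of; first by move/eqP: n_neq3; lia.
by have <- : n - -1 + 1 = n + 2 by lia.
Qed.

End Surjectivity.

(** * Degeneration *)

Theorem proposition5p3 (k : nat) (k_ge2 : (2 <= k)%N) :
  (* d^2 : E^2_{1,k-3} -> E^2_{-1,k-2} *)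
  (forall y : E_page k 2 (1 - 2) (k%:Z - 3 + 2 - 1),
     exists x : E_page k 2 1 (k%:Z - 3), E_diff x = y)
  /\ (forall (r : nat) (p q : int), (3 <= r)%N ->
        forall x : E_page k r p q, E_diff x = 0)
  /\ (forall p q : int, E_page k 3 p q = E_infty k p q).
Proof.
have F_mono m n : (filt k (m - 1) n <= filt k m n)%VS by apply: filt_mono; lia.
have F_step (m m' n : int) w : m <= m' -> w \in filt k m n -> w \in filt k m' n.
  by move=> le_m; apply: subvP; apply: filt_mono.
split; [|split].
- (* filtration below -1 is zero, so y is represented by a cycle of the column
     -1; its preimage under d in filtration 1 is an approximate cycle of order 2 *)
  move=> y; have y_num := sq_repr_num y; set b := sq_repr y in y_num.
  have [Fb db] : b \in filt k (-1) (k%:Z - 3) /\ d_tot k b = 0.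
    have F0 n : filt k (1 - 2 - 1) n = 0%VS by apply: filt_low.
    have F0' n : filt k (1 - 2 - 2%:Z) n = 0%VS by apply: filt_low.
    move: y_num; rewrite /= F0 addv0 memv_cap -memv_preim F0' memv0.
    case/andP=> Fb /eqP ->; split=> //; move: Fb; congr (_ \in filt _ _ _); lia.
  have [a Fa da] := col_cycle_bounds k_ge2 Fb db.
  exists (sq_class _ a).
  rewrite /E_diff page_diffE //; last 1 first.
  + rewrite memv_cap -memv_preim da.
    rewrite (_ : 1 + (k%:Z - 3) = k%:Z - 2) ?Fa; last by lia.
    by move: Fb; congr (_ \in filt _ _ _); lia.
  + by rewrite da sq_reprK.
  + exact: filt_d.
  + exact: d_tot_sq0.
- (* d a is a cycle of filtration p - r, so it bounds a chain v of filtration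
     p - r + 2 <= p - 1, and d v lies in the denominator of the target *)
  move=> r p q r_ge3 x; rewrite /E_diff /page_diff.
  set a := addv_pi1 _ _ _; have : a \in approx_cycles (filt k) (d_tot k) r p q.
    exact: memv_pi1.
  rewrite memv_cap -memv_preim => /andP[Fa Fda].
  set S' := page _ _ _ _ _.
  suff da_den : d_tot k a \in sq_den S'.
    have den_num w : w \in sq_den S' -> w \in sq_num S'.
      apply/subvP/addvS; last exact: subvv.
      apply/subvP=> _ /memv_imgP[v + ->]; rewrite !memv_cap -!memv_preim => /andP[_ Fdv].
      rewrite d_tot_d_tot mem0v andbT; move: Fdv; congr (_ \in filt _ _ _); lia.
    rewrite -[RHS](_ : sq_class S' 0 = 0); last first.
      rewrite /sq_class linear0; exact: raddf0.
    by apply/sq_classP; rewrite ?subr0 ?mem0v //; apply: den_num.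
  have [top|n_neq] := eqVneq (p + q - 1) (k%:Z - 2).
    have a0 : a = 0.
      apply/eqP; rewrite -memv0; have <- : tot k (p + q) = 0%VS by apply: tot_top; lia.
      by apply: subvP Fa; apply: filt_tot.
    by rewrite a0 linear0 mem0v.
  have [v Fv dv] := cycle_bounds k_ge2 n_neq Fda (d_tot_d_tot a).
  apply: (subvP (addvSl _ _)); rewrite -dv; apply: memv_img.
  rewrite memv_cap -memv_preim dv; apply/andP; split.
    move: Fv.
    rewrite (_ : p + q - 1 + 1 = p - r%:Z + r%:Z - 1 + (q + r%:Z - 1 - r%:Z + 2)); last by lia.
    by apply: F_step; lia.
  move: Fda.
  rewrite (_ : p + q - 1 = p - r%:Z + r%:Z - 1 + (q + r%:Z - 1 - r%:Z + 2) - 1); last by lia.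
  by apply: F_step; lia.
have top_eq0 m n : k%:Z - 1 <= n -> filt k m n = 0%VS.
  by move=> n_ge; apply/eqP; rewrite -subv0 -(tot_top n_ge) filt_tot.
move=> p q; congr Subquot; apply/eqP; rewrite eqEsubv; apply/andP; split.
- (* d a bounds some v of filtration p - 1, and a - v is a cycle *)
  rewrite subv_add addvSr andbT; apply/subvP=> a.
  rewrite memv_cap -memv_preim => /andP[Fa Fda].
  have [top|n_neq] := eqVneq (p + q - 1) (k%:Z - 2).
    by move: Fa; rewrite top_eq0 ?memv0 => [/eqP ->|]; [rewrite mem0v|lia].
  have [v Fv dv] := cycle_bounds k_ge2 n_neq Fda (d_tot_d_tot a).
  have {}Fv : v \in filt k (p - 1) (p + q).
    by move: Fv; congr (_ \in filt _ _ _); lia.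
  rewrite -[a](subrK v) memv_add // memv_cap memv_ker linearB /= dv subrr eqxx.
  by rewrite rpredB // (F_step _ _ _ _ _ Fv) //; lia.
- apply: addvS => //; apply/subvP=> a.
  rewrite !memv_cap -memv_preim memv_ker => /andP[-> /eqP ->].
  exact: mem0v.
- apply: addvS => //; apply/subvP=> _ /memv_imgP[a + ->].
  rewrite !memv_cap -memv_preim => /andP[Fa Fda]; apply/andP; split.
    by apply: etrans Fda; congr (_ \in filt _ _ _); lia.
  apply: memv_img; move: (subvP (filt_tot _ _ _) _ Fa).
  by congr (_ \in tot _ _); lia.
(* a boundary of filtration p bounds a chain of filtration p + 2 *)
apply: addvS => //; apply/subvP=> b.
rewrite memv_cap => /andP[Fb /memv_imgP[a Ta b_da]].
have db : d_tot k b = 0 by rewrite b_da d_tot_d_tot.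
have [top|n_neq] := eqVneq (p + q) (k%:Z - 2).
  move: Ta; rewrite tot_top ?memv0 => [/eqP a0|]; last by lia.
  by rewrite b_da a0 linear0 mem0v.
have [v Fv dv] := cycle_bounds k_ge2 n_neq Fb db.
rewrite -dv memv_img // memv_cap -memv_preim dv; apply/andP; split.
  by move: Fv; congr (_ \in filt _ _ _); lia.
by move: Fb; congr (_ \in filt _ _ _); lia.
Qed.
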